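(* Let $m\ge2$ be an integer, $0<r<1$, $G=\{z\in\mathbb{C}:|z^m-1|<r^m\}$, and let $p_n(z)=z^n+\cdots$ be the monic Bergman polynomials of $G$. The following representations hold: $$p_{km+m-1}(z)=z^{m-1}(z^m-1)^k,$$ and for $s=0,1,\ldots,m-2$ we have, for $k$ sufficiently large, $$\frac{p_{km+s}(z)\,(z^m-1+r^{2m})}{z^s\,r^{m(k+1)}}=\pi_{k+1,s}(w)-\frac{\pi_{k+1,s}(-r^m)}{\pi_{k,s}(-r^m)}\,\pi_{k,s}(w),$$ where $w=(z^m-1)/r^m$ and $\pi_{n,s}(w)$ is the monic polynomial of degree $n$ in $w$ that is orthogonal on the circle $|w|=1$ with respect to the weight $$\frac{|dw|}{|r^mw+1|^{2-\frac2m-\frac{2s}m}}.$$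
   Context: The Bergman polynomials $P_n(z)=\lambda_nz^n+\cdots$, $\lambda_n>0$, of $G$ are the orthonormalization of $1,z,z^2,\ldots$ with respect to $\int_Gf\,\overline{g}\,dA$ ($dA$ is area measure), and $p_n=P_n/\lambda_n$ are the monic ones. $|dw|$ is arc-length measure; $\pi_{n,s}$ orthogonal means orthogonal in $L^2$ of the given weight on $|w|=1$ to all polynomials of degree $<n$. By rotational symmetry $p_{km+s}(z)=z^sq_{k,s}(z^m)$ for a monic polynomial $q_{k,s}$ of degree $k$, for $0\le s\le m-1$. *)

(* Defs.v *)
From HB Require Import structures.
From mathcomp Require Export all_boot all_order all_algebra.
From mathcomp Require Export complex.
From mathcomp Require Export all_classical all_reals all_analysis.
Export Order.TTheory GRing.Theory Num.Theory.
Export numFieldNormedType.Exports.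

Set Implicit Arguments.
Unset Strict Implicit.
Unset Printing Implicit Defensive.

Local Open Scope classical_set_scope.
Local Open Scope ring_scope.

Section Bergman.
Context {R : realType}.
Local Notation C := R[i].

(* The norm of R[i] takes values in R[i]; this is the real-valued modulus. *)
Definition cmod (z : C) : R := complex.Re `|z|.

Definition Cintegral d (T : measurableType d) (mu : {measure set T -> \bar R})
    (D : set T) (f : T -> C) : C :=
  Complex (Rintegral mu D (fun x => complex.Re (f x)))
          (Rintegral mu D (fun x => complex.Im (f x))).

Definition area_integral (G : set C) (f : C -> C) : C :=
  Cintegral ((@lebesgue_measure R) \x (@lebesgue_measure R))%E [set xy | G (Complex xy.1 xy.2)]
    (fun xy => f (Complex xy.1 xy.2)).

Definition circle_integral (f : C -> C) : C :=
  Cintegral lebesgue_measure `[0, 2 * pi]%classic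
    (fun t => f (Complex (cos t) (sin t))).

Definition area_ip (G : set C) (f g : {poly C}) : C :=
  area_integral G (fun z => f.[z] * (g.[z])^*%C).

(* Positivity of the leading coefficient is the order of C, so it includes
   its being real. *)
Definition is_bergman_polys (G : set C) (P : nat -> {poly C}) : Prop :=
  (forall n, size (P n) = n.+1 /\ 0 < lead_coef (P n)) /\
  (forall i j, area_ip G (P i) (P j) = (i == j)%:R).

Definition monic_of (P : nat -> {poly C}) (n : nat) : {poly C} :=
  (lead_coef (P n))^-1 *: P n.

Definition circle_ip (h : C -> R) (f g : {poly C}) : C :=
  circle_integral (fun w => f.[w] * (g.[w])^*%C * (h w)%:C%C).

Definition is_monic_orthogonal (h : C -> R) (n : nat) (p : {poly C}) : Prop :=
  [/\ p \is monic, size p = n.+1 &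
      forall q : {poly C}, (size q <= n)%N -> circle_ip h p q = 0].

Definition lemniscate (m : nat) (r : R) : set C :=
  [set z | cmod (z ^+ m - 1) < r ^+ m].

Definition lemniscate_weight (m : nat) (r : R) (s : nat) (w : C) : R :=
  (cmod ((r ^+ m)%:C%C * w + 1) `^ (2 - 2 / m%:R - 2 * s%:R / m%:R))^-1.

End Bergman.

(* Main.v *)
Require Import Defs.
From mathcomp Require Import measurable_realfun zify ring lra.
From mathcomp Require Import cyclic separable cyclotomic.

Set Implicit Arguments.
Unset Strict Implicit.
Unset Printing Implicit Defensive.

(** Put [rho = r^m] and [w = (z^m - 1) / rho], so that [G = {|w| < 1}], and let
    [<f, g>] be the inner product of [L^2(G)].  Green's formula applied to the
    function [(1 - |w|^2) F conj(g)], which vanishes on the boundary of [G], gives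
    [<w F, (w g)'> = <F, g'>] for all polynomials [F], [g].  For
    [E(f, g) = <z^s f(w), (z^(s+1) g(w))'>] this says that [E(w^a, w^b)] depends on
    [a - b] only; combined with the hermitian symmetry of [<,>] it yields a
    three-term recurrence for these moments.  The moments of the weight
    [|1 + rho w|^(2 sigma - 2)], [sigma = (s+1)/m], on [|w| = 1] satisfy the same
    recurrence, whose bounded solutions form a line, so
    [E(f, g) = kappa * circle_ip ((w + rho) f) g] for a constant [kappa].  No change
    of variables in the area integral is needed.

    Since [(1 + rho w)^l = z^(l m)], orthogonality of [(w + rho) q] on the circle to
    the polynomials of degree [< k] is therefore orthogonality of [z^s q(w)] in [G] to
    [z^(s + l m)], [l < k]; the other powers of [z] are orthogonal to it by the
    rotational symmetry of [G].  Taking [(w + rho) q] to be the right-hand side of the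
    claimed identity gives the formula.  If [pi_k(-rho)] were [0],
    [q = pi_k / (w + rho)] would make [z^s q(w)] orthogonal to itself; hence the
    formula holds for every [k]. *)

Local Open Scope classical_set_scope.
Local Open Scope ring_scope.

(** * Complex-valued integrals *)

Section ComplexIntegral.
Context {R : realType} d (T : measurableType d).
Variables (mu : {measure set T -> \bar R}) (D : set T).
Hypothesis mD : measurable D.
Local Notation C := R[i].
Local Notation CRe := (@complex.Re R).
Local Notation CIm := (@complex.Im R).
Implicit Types f g : T -> C.

Lemma ReD (a b : C) : CRe (a + b) = CRe a + CRe b.
Proof. by case: a b => [? ?] [? ?]. Qed.

Lemma ImD (a b : C) : CIm (a + b) = CIm a + CIm b.
Proof. by case: a b => [? ?] [? ?]. Qed.

Lemma ReM (a b : C) : CRe (a * b) = CRe a * CRe b - CIm a * CIm b.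
Proof. by case: a b => [? ?] [? ?]. Qed.

Lemma ImM (a b : C) : CIm (a * b) = CRe a * CIm b + CIm a * CRe b.
Proof. by case: a b => [? ?] [? ?]. Qed.

Lemma ReJ (a : C) : CRe a^*%C = CRe a.
Proof. by case: a. Qed.

Lemma ImJ (a : C) : CIm a^*%C = - CIm a.
Proof. by case: a. Qed.

Lemma conjcD (a b : C) : (a + b)^*%C = a^*%C + b^*%C.
Proof. exact: rmorphD. Qed.

Lemma conjcB (a b : C) : (a - b)^*%C = a^*%C - b^*%C.
Proof. exact: rmorphB. Qed.

Lemma conjcM (a b : C) : (a * b)^*%C = a^*%C * b^*%C.
Proof. exact: rmorphM. Qed.

Lemma conjcX (a : C) n : (a ^+ n)^*%C = a^*%C ^+ n.
Proof. exact: rmorphXn. Qed.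

Lemma complex_ext (a b : C) : CRe a = CRe b -> CIm a = CIm b -> a = b.
Proof. by case: a b => [? ?] [? ?] /= -> ->. Qed.

Definition Cintegrable f :=
  mu.-integrable D (EFin \o (CRe \o f)) /\ mu.-integrable D (EFin \o (CIm \o f)).

Lemma CintegrableD f g : Cintegrable f -> Cintegrable g ->
  Cintegrable (fun x => f x + g x).
Proof.
move=> [fr fi] [gr gi]; split.
  apply: eq_integrable (integrableD mD fr gr) => // x _ /=.
  by rewrite -EFinD ReD.
apply: eq_integrable (integrableD mD fi gi) => // x _ /=.
by rewrite -EFinD ImD.
Qed.

Lemma integrable_lin2 (u v : T -> R) (a b : R) :
  mu.-integrable D (EFin \o u) -> mu.-integrable D (EFin \o v) ->
  mu.-integrable D (EFin \o (fun x => a * u x + b * v x)).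
Proof.
move=> iu iv.
apply: eq_integrable (integrableD mD (integrableZl mD a iu) (integrableZl mD b iv)) => //.
Qed.

Lemma Rintegral_lin2 (u v : T -> R) (a b : R) :
  mu.-integrable D (EFin \o u) -> mu.-integrable D (EFin \o v) ->
  Rintegral mu D (fun x => a * u x + b * v x)
  = a * Rintegral mu D u + b * Rintegral mu D v.
Proof.
move=> iu iv; rewrite -!RintegralZl// RintegralD//.
  exact: (integrableZl mD a iu).
exact: (integrableZl mD b iv).
Qed.

Lemma CintegrableZ (c : C) f : Cintegrable f -> Cintegrable (fun x => c * f x).
Proof.
move=> [fr fi]; split.
  apply: eq_integrable (integrable_lin2 (CRe c) (- CIm c) fr fi) => // x _ /=.
  by rewrite ReM mulNr.
apply: eq_integrable (integrable_lin2 (CRe c) (CIm c) fi fr) => // x _ /=.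
by rewrite ImM.
Qed.

Lemma CintegralD f g : Cintegrable f -> Cintegrable g ->
  Cintegral mu D (fun x => f x + g x) = Cintegral mu D f + Cintegral mu D g.
Proof.
move=> [fr fi] [gr gi]; apply: complex_ext; rewrite ?ReD ?ImD /=.
  by rewrite -RintegralD//; apply: eq_Rintegral => x _; rewrite ReD.
by rewrite -RintegralD//; apply: eq_Rintegral => x _; rewrite ImD.
Qed.

Lemma CintegralZ (c : C) f : Cintegrable f ->
  Cintegral mu D (fun x => c * f x) = c * Cintegral mu D f.
Proof.
move=> [fr fi]; apply: complex_ext; rewrite ?ReM ?ImM /=.
  rewrite -mulNr -Rintegral_lin2//; apply: eq_Rintegral => x _.
  by rewrite ReM mulNr.
by rewrite -Rintegral_lin2//; apply: eq_Rintegral => x _; rewrite ImM.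
Qed.

Lemma Cintegral_conj f : Cintegrable f ->
  Cintegral mu D (fun x => (f x)^*%C) = (Cintegral mu D f)^*%C.
Proof.
move=> [fr fi]; apply: complex_ext; rewrite ?ReJ ?ImJ /=.
  by apply: eq_Rintegral => x _; rewrite ReJ.
rewrite -mulN1r -RintegralZl//; apply: eq_Rintegral => x _.
by rewrite ImJ mulN1r.
Qed.

Lemma eq_Cintegral f g : (forall x, D x -> f x = g x) ->
  Cintegral mu D f = Cintegral mu D g.
Proof.
move=> fg; apply: complex_ext => /=; apply: eq_Rintegral => x /set_mem /fg ->//.
Qed.

Definition Cmeasurable (A : set T) f :=
  measurable_fun A (CRe \o f) /\ measurable_fun A (CIm \o f).

(** The bound is on the two components rather than on the modulus, which is why a product costs the
    factor 2 in [CboundedM]. *)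
Definition Cbounded (M : R) f :=
  forall x, D x -> `|CRe (f x)| <= M /\ `|CIm (f x)| <= M.

Lemma CmeasurableD A f g : Cmeasurable A f -> Cmeasurable A g ->
  Cmeasurable A (fun x => f x + g x).
Proof.
move=> [fr fi] [gr gi]; split.
  rewrite [X in measurable_fun _ X](_ : _ = (CRe \o f) \+ (CRe \o g)).
    exact: measurable_funD.
  by apply/funext => x /=; rewrite ReD.
rewrite [X in measurable_fun _ X](_ : _ = (CIm \o f) \+ (CIm \o g)).
  exact: measurable_funD.
by apply/funext => x /=; rewrite ImD.
Qed.

Lemma CmeasurableM A f g : Cmeasurable A f -> Cmeasurable A g ->
  Cmeasurable A (fun x => f x * g x).
Proof.
move=> [fr fi] [gr gi]; split.
  rewrite [X in measurable_fun _ X](_ : _ =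
    ((CRe \o f) \* (CRe \o g)) \- ((CIm \o f) \* (CIm \o g))).
    by apply: measurable_funB; exact: measurable_funM.
  by apply/funext => x /=; rewrite ReM.
rewrite [X in measurable_fun _ X](_ : _ =
    ((CRe \o f) \* (CIm \o g)) \+ ((CIm \o f) \* (CRe \o g))).
  by apply: measurable_funD; exact: measurable_funM.
by apply/funext => x /=; rewrite ImM.
Qed.

Lemma CmeasurableJ A f : Cmeasurable A f -> Cmeasurable A (fun x => (f x)^*%C).
Proof.
move=> [fr fi]; split.
  by rewrite [X in measurable_fun _ X](_ : _ = CRe \o f)//; apply/funext => x /=; rewrite ReJ.
rewrite [X in measurable_fun _ X](_ : _ = \- (CIm \o f)).
  exact: measurable_funN.
by apply/funext => x /=; rewrite ImJ.
Qed.

Lemma Cmeasurable_cst A (c : C) : Cmeasurable A (fun=> c).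
Proof. by split; exact: measurable_cst. Qed.

Lemma CboundedD M N f g : Cbounded M f -> Cbounded N g ->
  Cbounded (M + N) (fun x => f x + g x).
Proof.
move=> bf bg x Dx; have [fr fi] := bf x Dx; have [gr gi] := bg x Dx.
by rewrite ReD ImD; split; apply: (le_trans (ler_normD _ _)); exact: lerD.
Qed.

Lemma CboundedM M N f g : Cbounded M f -> Cbounded N g ->
  Cbounded (2 * (M * N)) (fun x => f x * g x).
Proof.
move=> bf bg x Dx; have [fr fi] := bf x Dx; have [gr gi] := bg x Dx.
rewrite ReM ImM mulr_natl mulr2n; split.
  by apply: (le_trans (ler_normB _ _)); rewrite !normrM; apply: lerD; exact: ler_pM.
by apply: (le_trans (ler_normD _ _)); rewrite !normrM; apply: lerD; exact: ler_pM.
Qed.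

Lemma CboundedJ M f : Cbounded M f -> Cbounded M (fun x => (f x)^*%C).
Proof. by move=> bf x Dx; have [fr fi] := bf x Dx; rewrite ReJ ImJ normrN. Qed.

Hypothesis fD : (mu D < +oo)%E.

Lemma bounded_Cintegrable M f : Cmeasurable D f -> Cbounded M f -> Cintegrable f.
Proof.
move=> [mr mi] bf.
by split; apply: measurable_bounded_integrable => //;
  exists M; split; rewrite ?num_real// => x Mx y Dy;
  have [? ?] := bf y Dy; apply: (le_trans _ (ltW Mx)).
Qed.

(** The modulus is at most [|Re| + |Im|], and each component contributes [M * mu D]. This later
    yields the boundedness of the moment sequences. *)
Lemma Cbounded_Cintegral M f : Cintegrable f -> Cbounded M f ->
  cmod (Cintegral mu D f) <= 2 * (M * fine (mu D)).
Proof.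
move=> [fr fi] bf.
have key (u : T -> R) : mu.-integrable D (EFin \o u) ->
    (forall x, D x -> `|u x| <= M) -> `|Rintegral mu D u| <= M * fine (mu D).
  move=> iu uM; apply: (le_trans (le_normr_Rintegral mD iu)).
  rewrite -Rintegral_cst//; apply: le_Rintegral => //.
    exact: integrable_norm iu.
  apply: measurable_bounded_integrable => //.
  by exists `|M|; split; rewrite ?num_real// => x Mx y _; exact: ltW.
have hr := key _ fr (fun x Dx => (bf x Dx).1).
have hi := key _ fi (fun x Dx => (bf x Dx).2).
rewrite /cmod normc_def /= mulr_natl mulr2n.
apply: le_trans (lerD hr hi).
rewrite -[leRHS]ger0_norm ?addr_ge0// -sqrtr_sqr ler_wsqrtr//.
rewrite sqrrD !real_normK ?num_real//.
by rewrite -addrA lerD2l addrC lerDl mulrn_wge0// mulr_ge0.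
Qed.

End ComplexIntegral.

(** * The area inner product *)

Section AreaInnerProduct.
Context {R : realType}.
Local Notation C := R[i].
Local Notation CRe := (@complex.Re R).
Local Notation CIm := (@complex.Im R).
Local Notation leb2 := ((@lebesgue_measure R) \x (@lebesgue_measure R))%E.
Local Notation planar G := [set xy : measurableTypeR R * measurableTypeR R | G (Complex xy.1 xy.2)].

Lemma Cmeasurable_horner (p : {poly C}) :
  Cmeasurable setT (fun xy : measurableTypeR R * measurableTypeR R =>
    p.[Complex xy.1 xy.2]).
Proof.
elim/poly_ind: p => [|p c IH].
  have -> : (fun xy : measurableTypeR R * measurableTypeR R =>
    (0 : {poly C}).[Complex xy.1 xy.2]) = fun=> 0.
    by apply/funext => xy; rewrite horner0.
  exact: Cmeasurable_cst.
rewrite (_ : (fun xy => _) = fun xy => p.[Complex xy.1 xy.2] * Complex xy.1 xy.2 + c).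
  apply: CmeasurableD; last exact: Cmeasurable_cst.
  apply: CmeasurableM => //; split.
    by rewrite [X in measurable_fun _ X](_ : _ = fst)//; exact: measurable_fst.
  by rewrite [X in measurable_fun _ X](_ : _ = snd)//; exact: measurable_snd.
by apply/funext => xy; rewrite !hornerE.
Qed.

Variables (G : set C) (L : R).
Hypothesis mG : measurable (planar G).
Hypothesis bG : forall x y, G (Complex x y) -> `|x| <= L /\ `|y| <= L.

Lemma planar_lty : (leb2 (planar G) < +oo)%E.
Proof.
have mbox : measurable (`[- L, L]%classic : set (measurableTypeR R)).
  exact: measurable_itv.
apply: (@le_lt_trans _ _ (leb2 (`[- L, L]%classic `*` `[- L, L]%classic))).
  apply: le_measure; rewrite ?inE//; first exact: measurableX.
  by move=> [x y] /= /bG[]; rewrite !ler_norml !in_itv.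
have box_lty : (lebesgue_measure (`[(- L)%R, L%R]%classic : set R) < +oo)%E.
  by rewrite lebesgue_measure_itv /=; case: ifP => _; rewrite -?EFinB ltry.
by rewrite product_measure1E// lte_mul_pinfty// ge0_fin_numE.
Qed.

Lemma Cbounded_horner (p : {poly C}) :
  exists M, Cbounded (planar G) M (fun xy => p.[Complex xy.1 xy.2]).
Proof.
elim/poly_ind: p => [|p c [M IH]].
  by exists 0 => xy _; rewrite horner0 /= normr0.
have bz : Cbounded (planar G) L (fun xy => Complex xy.1 xy.2).
  by move=> xy /= /bG.
have bc : Cbounded (planar G) (`|CRe c| + `|CIm c|) (fun=> c).
  by move=> xy _; rewrite lerDl lerDr.
exists (2 * (M * L) + (`|CRe c| + `|CIm c|)) => xy Gxy.
by have := CboundedD (CboundedM IH bz) bc Gxy; rewrite hornerMXaddC.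
Qed.

Lemma area_integrable (p q : {poly C}) :
  Cintegrable leb2 (planar G)
    (fun xy => p.[Complex xy.1 xy.2] * (q.[Complex xy.1 xy.2])^*%C).
Proof.
have [M pM] := Cbounded_horner p; have [N qN] := Cbounded_horner q.
apply: (bounded_Cintegrable mG planar_lty _ (CboundedM pM (CboundedJ qN))).
have [m1 m2] := CmeasurableM (Cmeasurable_horner p) (CmeasurableJ (Cmeasurable_horner q)).
by split; exact: measurable_funTS.
Qed.

Lemma area_ipDl (f g h : {poly C}) : area_ip G (f + g) h = area_ip G f h + area_ip G g h.
Proof.
rewrite /area_ip /area_integral -CintegralD//; [|exact: area_integrable..].
by apply: eq_Cintegral => xy _; rewrite hornerD mulrDl.
Qed.

Lemma area_ipZl (c : C) (f h : {poly C}) : area_ip G (c *: f) h = c * area_ip G f h.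
Proof.
rewrite /area_ip /area_integral -CintegralZ//; last exact: area_integrable.
by apply: eq_Cintegral => xy _; rewrite hornerZ mulrA.
Qed.

Lemma area_ip_conj (f g : {poly C}) : (area_ip G f g)^*%C = area_ip G g f.
Proof.
rewrite /area_ip /area_integral -Cintegral_conj//; last exact: area_integrable.
by apply: eq_Cintegral => xy _; rewrite conjcM conjcK mulrC.
Qed.

Lemma area_ipDr (f g h : {poly C}) : area_ip G h (f + g) = area_ip G h f + area_ip G h g.
Proof. by rewrite -area_ip_conj area_ipDl conjcD !area_ip_conj. Qed.

Lemma area_ipZr (c : C) (f h : {poly C}) : area_ip G h (c *: f) = c^*%C * area_ip G h f.
Proof. by rewrite -area_ip_conj area_ipZl conjcM area_ip_conj. Qed.

Lemma area_ip0l (f : {poly C}) : area_ip G 0 f = 0.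
Proof. by rewrite -[0](scale0r f) area_ipZl mul0r. Qed.

Lemma area_ip0r (f : {poly C}) : area_ip G f 0 = 0.
Proof. by rewrite -area_ip_conj area_ip0l conjc0. Qed.

Lemma area_ip_suml (I : Type) (s : seq I) (F : I -> {poly C}) g :
  area_ip G (\sum_(i <- s) F i) g = \sum_(i <- s) area_ip G (F i) g.
Proof.
by elim/big_rec2: _ => [|i x y _ <-]; rewrite ?area_ip0l ?area_ipDl.
Qed.

Lemma area_ip_sumr (I : Type) (s : seq I) (F : I -> {poly C}) g :
  area_ip G g (\sum_(i <- s) F i) = \sum_(i <- s) area_ip G g (F i).
Proof.
by elim/big_rec2: _ => [|i x y _ <-]; rewrite ?area_ip0r ?area_ipDr.
Qed.

(** * Consequences of orthonormality of the Bergman polynomials *)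

Section Orthonormal.
Variable P : nat -> {poly C}.
Hypothesis hP : is_bergman_polys G P.

Lemma size_bergman n : size (P n) = n.+1. Proof. exact: (hP.1 n).1. Qed.

Lemma lead_bergman_neq0 n : lead_coef (P n) != 0.
Proof. by rewrite lt0r_neq0//; exact: (hP.1 n).2. Qed.

Lemma bergman_expansion (f : {poly C}) n : (size f <= n)%N ->
  exists a : nat -> C, f = \sum_(0 <= i < n) a i *: P i.
Proof.
elim: n f => [|n IH] f fn.
  by exists (fun=> 0); rewrite big_geq//; apply/eqP; rewrite -size_poly_leq0.
pose c := f`_n / lead_coef (P n).
have [|a ha] := IH (f - c *: P n).
  apply/leq_sizeP => j nj; rewrite coefB coefZ.
  move: nj; rewrite leq_eqVlt => /predU1P[<-|nj].
    have -> : (P n)`_n = lead_coef (P n) by rewrite lead_coefE size_bergman.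
    by rewrite divfK ?subrr// lead_bergman_neq0.
  by rewrite !nth_default ?mulr0 ?subr0// ?size_bergman// (leq_trans fn).
exists (fun i => if (i == n)%N then c else a i).
rewrite big_nat_recr//= eqxx; apply/eqP; rewrite -subr_eq; apply/eqP.
by rewrite ha; apply: eq_big_nat => i /andP[_ /ltn_eqF ->].
Qed.

(** Definiteness is read off the orthonormal system, not off the measure: expanding [f] in the [P i]
    turns [<f, f>] into the sum of the [|a i|^2]. *)
Lemma area_ip_definite (f : {poly C}) : area_ip G f f = 0 -> f = 0.
Proof.
have [a -> ff0] := bergman_expansion (leqnn (size f)).
have {}ff0 : \sum_(0 <= i < size f) a i * (a i)^*%C = 0.
  rewrite -[RHS]ff0 area_ip_suml; apply: eq_big_nat => i /andP[_ ilt].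
  rewrite area_ipZl area_ip_sumr; congr (_ * _).
  rewrite (bigD1_seq i) ?mem_index_iota ?iota_uniq//= area_ipZr hP.2 eqxx mulr1.
  rewrite big1 ?addr0// => j ji; rewrite area_ipZr hP.2 eq_sym (negbTE ji) mulr0//.
apply: big1_seq => i /= ilt.
move/eqP: ff0; rewrite psumr_eq0; last by move=> j _; exact: mulcJ_ge0.
move=> /allP/(_ i ilt)/=; rewrite mulf_eq0 conjc_eq0 orbb => /eqP ->.
by rewrite scale0r.
Qed.

Lemma monic_of_orthogonal n (q : {poly C}) : (size q <= n)%N ->
  area_ip G (monic_of P n) q = 0.
Proof.
move=> /bergman_expansion[a ->]; rewrite area_ip_sumr big_nat.
apply: big1 => i /andP[_ ilt].
by rewrite /monic_of area_ipZl area_ipZr hP.2 (gtn_eqF ilt) !mulr0.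
Qed.

(** The difference of the two monic polynomials has degree [< n] and is orthogonal to all such
    polynomials, hence to itself. *)
Lemma monic_of_unique n (f : {poly C}) : f \is monic -> size f = n.+1 ->
  (forall j, (j < n)%N -> area_ip G f 'X^j = 0) -> monic_of P n = f.
Proof.
move=> fm sf fX.
have pm : monic_of P n \is monic.
  by rewrite monicE lead_coefZ mulVf// lead_bergman_neq0.
have sp : size (monic_of P n) = n.+1.
  by rewrite size_scale ?size_bergman// invr_eq0 lead_bergman_neq0.
apply/eqP; rewrite -subr_eq0; apply/eqP/area_ip_definite.
have sd : (size (monic_of P n - f)%R <= n)%N.
  apply/leq_sizeP => j; rewrite leq_eqVlt => /predU1P[<-|nj].
    by move: pm fm; rewrite !monicE !lead_coefE coefB sp sf => /eqP -> /eqP ->; rewrite subrr.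
  by rewrite coefB !nth_default ?subrr ?sp ?sf.
rewrite -{1}scaleN1r.
rewrite area_ipDl monic_of_orthogonal// area_ipZl add0r.
set d := (X in area_ip _ _ X).
have -> : d = \sum_(0 <= i < n) (d`_i) *: 'X^i.
  rewrite big_mkord -{1}[d](coefK d).
  rewrite poly_def (big_ord_widen n (fun i => d`_i *: 'X^i))// big_mkcond /=.
  by apply: eq_bigr => i _; case: ltnP => // /leq_sizeP ->; rewrite ?scale0r.
rewrite area_ip_sumr big_nat big1 ?mulr0// => i /andP[_ ilt].
by rewrite area_ipZr fX// mulr0.
Qed.

End Orthonormal.
End AreaInnerProduct.

(** * Green's formula on a sublevel set *)

Section RealLine.
Context {R : realType}.
Implicit Types (f F u du Phi dPhi : R -> R) (a b : R).

Lemma derive_continuous F (dF : R -> R) : (forall x : R, is_derive x 1 F (dF x)) ->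
  continuous F.
Proof.
move=> h x; apply: differentiable_continuous; apply/derivable1_diffP.
exact: (@ex_derive _ _ _ _ _ _ _ (h x)).
Qed.

Lemma Rintegral_FTC F f a b : a < b -> (forall x : R, is_derive x 1 F (f x)) ->
  continuous f -> (\int[lebesgue_measure]_(x in `[a, b]) f x = F b - F a)%R.
Proof.
move=> ab dF cf; rewrite /Rintegral (continuous_FTC2 ab (F := F)) //.
- exact: continuous_subspaceT.
- have cF := derive_continuous dF.
  split=> [x _||].
  + exact: (@ex_derive _ _ _ _ _ _ _ (dF x)).
  + exact/cvg_at_right_filter/cF.
  + exact/cvg_at_left_filter/cF.
- by move=> x _; rewrite derive1E (@derive_val _ _ _ _ _ _ _ (dF x)).
Qed.

(** Squaring removes the corner of the positive part, so a cutoff built from this function is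
    differentiable. At 0 the difference quotient at [h] is at most [|h|]. *)
Lemma is_derive_pos_sqr (x : R) :
  is_derive x 1 (fun t : R => Num.max 0 t ^+ 2) (2 * Num.max 0 x).
Proof.
have [x0|x0|->] := ltgtP x 0.
- rewrite mulr0.
  apply: (@near_eq_is_derive _ _ _ (cst 0)) => //.
  near=> t; rewrite max_l ?expr0n//.
  by apply: ltW; near: t; exact: lt_nbhsl.
- apply: (@near_eq_is_derive _ _ _ (fun t : R => t ^+ 2)).
    near=> t; rewrite max_r//.
    by apply: ltW; near: t; exact: lt_nbhsr.
  have := @is_deriveX _ _ (fun t : R => t) 2 x 1 1 (is_derive_id _ _).
  by move/is_derive_eq; apply; rewrite /= expr1 /GRing.scale /= mulr1.
- rewrite mulr0.
  have hc : h^-1 *: (Num.max 0 (h *: (1 : R) + 0) ^+ 2 - Num.max 0 (0 : R) ^+ 2)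
      @[h --> (0 : R)^'] --> (0 : R).
    apply/cvgrPdist_le => e e0; near=> h.
    rewrite maxxx expr0n subr0 addr0 sub0r normrN /GRing.scale /= mulr1.
    rewrite normrM normrX normfV.
    have h0 : h != 0 by near: h; exact: nbhs_dnbhs_neq.
    rewrite ler_pdivrMl ?normr_gt0//.
    have he : `|h| <= e.
      by near: h; exact: dnbhs0_le.
    have : `|Num.max 0 h| <= `|h| by rewrite /Num.max; case: ifP; rewrite ?normr0.
    by move=> hh; rewrite expr2; apply: ler_pM => //; exact: le_trans hh he.
  apply: DeriveDef; first by apply/cvg_ex; exists 0.
  by rewrite /derive; apply/cvg_lim.
Unshelve. all: by end_near. Qed.

Let M (t : R) : R := Num.max 0 t.
(** For [t > 0] this is [t^3 / (t^2 + e)], otherwise 0: a differentiable approximation of the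
    positive part as [e] tends to 0. Its derivative [dtheta] takes values in [[0, 3]]. *)
Let theta (e t : R) : R := t * M t ^+ 2 * (M t ^+ 2 + e)^-1.
Let dtheta (e t : R) : R :=
  M t ^+ 2 * (M t ^+ 2 + e)^-1 + 2 * M t ^+ 2 * e * (M t ^+ 2 + e)^-1 ^+ 2.

Let idM (t : R) : t * M t = M t * M t.
Proof. by rewrite /M; have [t0|t0] := leP 0 t; rewrite ?mulr0. Qed.

Let den_gt0 (e t : R) : 0 < e -> 0 < M t ^+ 2 + e.
Proof. by move=> e0; rewrite ltr_wpDl// sqr_ge0. Qed.

Let is_derive_theta (e : R) (u du : R -> R) (x : R) : 0 < e ->
  is_derive x 1 u (du x) ->
  is_derive x 1 (fun t => theta e (u t)) (dtheta e (u x) * du x).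
Proof.
move=> e0 hu.
have hp : is_derive x 1 (fun t => M (u t) ^+ 2) (2 * M (u x) * du x).
  exact: (is_derive1_comp (is_derive_pos_sqr (u x)) hu).
have hpe : is_derive x 1 (fun t => M (u t) ^+ 2 + e) (2 * M (u x) * du x).
  have := @is_deriveD _ _ _ _ _ _ _ _ _ hp (is_derive_cst e x (1 : R)).
  by move/is_derive_eq; apply; rewrite addr0.
have hne : M (u x) ^+ 2 + e != 0 by rewrite gt_eqF// den_gt0.
have hV := is_deriveV (f := fun t : R => M (u t) ^+ 2 + e) hne hpe.
have := is_deriveM (is_deriveM hu hp) hV.
move/is_derive_eq; apply; rewrite /dtheta /GRing.scale /= ?fctE.
move: hne; set N := M (u x) => hne.
(* This identity holds for both signs of [u x], so the derivative needs no case distinction. *)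
have uN : u x * N = N * N by exact: idM.
rewrite [LHS](_ : _ = (u x * N) * (N ^+ 2 * 2 * du x * - (N ^+ 2 + e) ^- 2) +
  (u x * N * 2 * du x + N ^+ 2 * du x) / (N ^+ 2 + e)); last by ring.
by rewrite uN; field.
Qed.

(** The integrand is [(u Phi)'] on [{u > 0}], and [u] vanishes on the boundary of that set inside
    [[a, b]]. To avoid describing the components of [{u > 0}], the positive part of [u] is replaced
    by [theta e (u x)], the fundamental theorem is applied on all of [[a, b]], and [e] tends to 0 by
    dominated convergence. *)
Lemma integral_derive_pos (u du Phi dPhi : R -> R) (a b : R) : a < b ->
  (forall x : R, is_derive x 1 u (du x)) -> (forall x : R, is_derive x 1 Phi (dPhi x)) ->
  continuous du -> continuous dPhi -> u a <= 0 -> u b <= 0 ->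
  (\int[lebesgue_measure]_(x in `[a, b])
     (if 0 < u x then du x * Phi x + u x * dPhi x else 0)%:E = 0)%E.
Proof.
move=> ab hu hPhi cdu cdPhi ua ub.
have cu := derive_continuous hu; have cPhi := derive_continuous hPhi.
have cM : continuous (fun x => M (u x)).
  by move=> x; apply: continuous_max; [exact: cvg_cst|exact: cu].
pose f e x := dtheta e (u x) * du x * Phi x + theta e (u x) * dPhi x.
pose f0 x := if 0 < u x then du x * Phi x + u x * dPhi x else 0.
have cV e : 0 < e -> continuous (fun x => (M (u x) ^+ 2 + e)^-1).
  move=> e0 x; apply: cvgV; first by rewrite gt_eqF// den_gt0.
  by apply: cvgD; [apply: cvgM; exact: cM|exact: cvg_cst].
have cf e : 0 < e -> continuous (f e).
  move=> e0 x; have := cV _ e0 x; have := cM x; have := cu x.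
  move=> ? ? ?; apply: cvgD; apply: cvgM => //; try exact: cPhi; try exact: cdPhi.
    apply: cvgM; last exact: cdu.
    apply: cvgD; apply: cvgM => //; try (apply: cvgM => //).
    by apply: cvgM; [exact: cvg_cst|apply: cvgM].
    exact: cvg_cst.
  apply: cvgM => //; apply: cvgM => //; exact: cvgM.
have If e : 0 < e -> (\int[lebesgue_measure]_(x in `[a, b]) f e x = 0)%R.
  move=> e0.
  rewrite (Rintegral_FTC (F := fun x => theta e (u x) * Phi x) ab _ (cf _ e0)); last first.
    move=> x; have := is_deriveM (is_derive_theta e0 (hu x)) (hPhi x).
    by move/is_derive_eq; apply; rewrite /GRing.scale /= /f; ring.
  by rewrite /theta /M !max_l// expr0n !mulr0 !mul0r subrr.
pose ep n : R := n.+1%:R^-1.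
have ep0 n : 0 < ep n by rewrite invr_gt0.
have epcvg : ep n @[n --> \oo] --> (0 : R) by exact: cvg_harmonic.
(* The dominating function: [|dtheta e t| <= 3] and [|theta e t| <= |t|], uniformly in [e]. *)
pose g x := 3 * `|du x| * `|Phi x| + `|u x| * `|dPhi x|.
have cg : continuous g.
  move=> x; apply: cvgD; apply: cvgM.
  - by apply: cvgM; [exact: cvg_cst|apply: cvg_norm; exact: cdu].
  - by apply: cvg_norm; exact: cPhi.
  - by apply: cvg_norm; exact: cu.
  - by apply: cvg_norm; exact: cdPhi.
have fcvg x : f (ep n) x @[n --> \oo] --> f0 x.
  rewrite /f /f0; case: ifPn => [u0|].
    have Mu : M (u x) = u x by rewrite /M max_r// ltW.
    have p0 : u x ^+ 2 + 0 != 0 by rewrite addr0 expf_neq0// gt_eqF.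
    have hV : (u x ^+ 2 + ep n)^-1 @[n --> \oo] --> (u x ^+ 2 + 0)^-1.
      by apply: cvgV => //; apply: cvgD => //; exact: cvg_cst.
    rewrite /dtheta /theta Mu.
    have -> : du x * Phi x + u x * dPhi x =
      (u x ^+ 2 * (u x ^+ 2 + 0)^-1 + 2 * u x ^+ 2 * 0 * (u x ^+ 2 + 0)^-1 ^+ 2) * du x * Phi x
      + u x * u x ^+ 2 * (u x ^+ 2 + 0)^-1 * dPhi x.
      by rewrite !addr0; field; rewrite gt_eqF.
    apply: cvgD; apply: cvgM; try exact: cvg_cst.
      apply: cvgM; last exact: cvg_cst.
      apply: cvgD; apply: cvgM => //; try exact: cvg_cst.
        by apply: cvgM => //; exact: cvg_cst.
      by rewrite expr2; exact: cvgM.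
    by apply: cvgM => //; exact: cvg_cst.
  rewrite -leNgt => u0.
  have Mu : M (u x) = 0 by rewrite /M max_l.
  under eq_fun do rewrite /dtheta /theta Mu expr0n /= !(mulr0, mul0r, addr0).
  exact: cvg_cst.
have fg e x : 0 < e -> `|f e x| <= g x.
  move=> e0; have p0 : 0 <= M (u x) ^+ 2 by exact: sqr_ge0.
  have d0 := den_gt0 (u x) e0.
  have t1 : 0 <= M (u x) ^+ 2 * (M (u x) ^+ 2 + e)^-1 <= 1.
    by apply/andP; split; [exact: divr_ge0 (ltW d0)|rewrite ler_pdivrMr// mul1r lerDl ltW].
  have t2 : 0 <= e * (M (u x) ^+ 2 + e)^-1 <= 1.
    by apply/andP; split; [exact: divr_ge0 (ltW e0) (ltW d0)|rewrite ler_pdivrMr// mul1r lerDr].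
  have dth : `|dtheta e (u x)| <= 3.
    rewrite /dtheta.
    rewrite [X in _ + X](_ : _ = 2 * ((M (u x) ^+ 2 * (M (u x) ^+ 2 + e)^-1) *
      (e * (M (u x) ^+ 2 + e)^-1))); last by ring.
    move: t1 t2; set A := M (u x) ^+ 2 * _; set B := e * _ => /andP[A0 A1] /andP[B0 B1].
    have AB0 : 0 <= A * B by exact: mulr_ge0.
    have AB1 : A * B <= 1 by rewrite mulr_ile1.
    by rewrite ger0_norm; lra.
  have th : `|theta e (u x)| <= `|u x|.
    rewrite /theta -mulrA normrM; move: t1 => /andP[A0 A1].
    by rewrite ler_piMr// ger0_norm.
  rewrite /f /g; apply: (le_trans (ler_normD _ _)); apply: lerD; rewrite normrM.
    rewrite normrM; by apply: ler_wpM2r => //; exact: ler_wpM2r.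
  exact: ler_wpM2r.
have mI : measurable (`[a, b]%classic : set (measurableTypeR R)) by exact: measurable_itv.
have mf e : 0 < e -> measurable_fun (`[a, b]%classic : set (measurableTypeR R)) (f e).
  move=> e0; apply: measurable_funTS; apply: continuous_measurable_fun; exact: cf.
have mf0 : measurable_fun (`[a, b]%classic : set (measurableTypeR R)) f0.
  by apply: (measurable_fun_cvg (h := fun n => f (ep n))) => [n|x _]; [exact: mf|exact: fcvg].
have fcvgE (x : measurableTypeR R) : (EFin \o f (ep n)) x @[n --> \oo] --> (EFin \o f0) x.
  by apply: cvg_EFin; [exact: nearW|exact: fcvg].
have cint (h : R -> R) : continuous h ->
    lebesgue_measure.-integrable (`[a, b]%classic : set (measurableTypeR R)) (EFin \o h).
  move=> ch; apply: continuous_compact_integrable; first exact: segment_compact.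
  exact: continuous_subspaceT.
have [||| _ _] := @dominated_convergence _ (measurableTypeR R) R lebesgue_measure _ mI
  (fun n => EFin \o f (ep n)) (EFin \o f0) (EFin \o g)
  (fun n => (measurable_EFinP _ _).2 (mf _ (ep0 n))) ((measurable_EFinP _ _).2 mf0).
- by apply: aeW => x _; exact: fcvgE.
- exact: cint.
- by apply: aeW => x n _; rewrite /= lee_fin; exact: fg.
rewrite [X in X @ _ --> _ -> _](_ : _ = fun=> 0%E); last first.
  apply/funext => n /=.
  rewrite -(fineK (integrable_fin_num mI (cint _ (cf _ (ep0 n))))).
  by congr (_%:E); exact: If.
move=> h0.
by apply/esym; apply: (cvg_unique _ _ h0) => //; exact: cvg_cst.
Qed.

End RealLine.

(** * Derivatives and continuity of complex functions of a real variable *)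

Section ComplexDerivative.
Context {R : realType}.
Local Notation C := R[i].
Local Notation CRe := (@complex.Re R).
Local Notation CIm := (@complex.Im R).
Implicit Types (f g df dg : R -> C).

Definition is_cderive f df :=
  forall x : R, is_derive x 1 (CRe \o f) (CRe (df x)) /\
                is_derive x 1 (CIm \o f) (CIm (df x)).

Definition Ccontinuous f := continuous (CRe \o f) /\ continuous (CIm \o f).

Lemma is_cderive_continuous f df : is_cderive f df -> Ccontinuous f.
Proof. by move=> h; split; apply: derive_continuous => x; have [] := h x. Qed.

Lemma eq_is_cderive f df dg : is_cderive f df -> df =1 dg -> is_cderive f dg.
Proof. by move=> h e x; rewrite -e. Qed.

Lemma is_cderive_cst (c : C) : is_cderive (fun=> c) (fun=> 0).
Proof. by move=> x; split; exact: is_derive_cst. Qed.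

Lemma is_cderiveD f df g dg : is_cderive f df -> is_cderive g dg ->
  is_cderive (fun x => f x + g x) (fun x => df x + dg x).
Proof.
move=> hf hg x; have [fr fi] := hf x; have [gr gi] := hg x; split.
  rewrite (_ : _ \o _ = (CRe \o f) + (CRe \o g)).
    by rewrite ReD; exact: is_deriveD.
  by apply/funext => t; rewrite /= ReD.
rewrite (_ : _ \o _ = (CIm \o f) + (CIm \o g)).
  by rewrite ImD; exact: is_deriveD.
by apply/funext => t; rewrite /= ImD.
Qed.

Lemma is_cderiveM f df g dg : is_cderive f df -> is_cderive g dg ->
  is_cderive (fun x => f x * g x) (fun x => df x * g x + f x * dg x).
Proof.
move=> hf hg x; have [fr fi] := hf x; have [gr gi] := hg x; split.
  rewrite (_ : _ \o _ = (CRe \o f) * (CRe \o g) - (CIm \o f) * (CIm \o g)).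
    apply: is_derive_eq (is_deriveB (is_deriveM fr gr) (is_deriveM fi gi)) _.
    by rewrite /GRing.scale /= ReD !ReM; ring.
  by apply/funext => t; rewrite /= ReM.
rewrite (_ : _ \o _ = (CRe \o f) * (CIm \o g) + (CIm \o f) * (CRe \o g)).
  apply: is_derive_eq (is_deriveD (is_deriveM fr gi) (is_deriveM fi gr)) _.
  by rewrite /GRing.scale /= ImD !ImM; ring.
by apply/funext => t; rewrite /= ImM.
Qed.

Lemma is_cderiveJ f df : is_cderive f df ->
  is_cderive (fun x => (f x)^*%C) (fun x => (df x)^*%C).
Proof.
move=> hf x; have [fr fi] := hf x; split.
  by rewrite ReJ (_ : _ \o _ = CRe \o f)//; apply/funext => t; rewrite /= ReJ.
rewrite ImJ (_ : _ \o _ = - (CIm \o f)); first exact: is_deriveN.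
by apply/funext => t; rewrite /= ImJ.
Qed.

Lemma is_cderive_horner (p : {poly C}) f df : is_cderive f df ->
  is_cderive (fun x => p.[f x]) (fun x => p^`().[f x] * df x).
Proof.
move=> hf; elim/poly_ind: p => [|p c IH].
  rewrite (_ : (fun x => _) = fun=> 0); last by apply/funext => t; rewrite horner0.
  by apply: eq_is_cderive (is_cderive_cst 0) _ => x; rewrite deriv0 horner0 mul0r.
rewrite (_ : (fun x => _) = fun x => p.[f x] * f x + c); last first.
  by apply/funext => t; rewrite hornerMXaddC.
apply: eq_is_cderive (is_cderiveD (is_cderiveM IH hf) (is_cderive_cst c)) _ => x.
by rewrite derivMXaddC !hornerE; ring.
Qed.

Lemma CcontinuousD f g : Ccontinuous f -> Ccontinuous g ->
  Ccontinuous (fun x => f x + g x).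
Proof.
move=> [fr fi] [gr gi]; split.
  rewrite (_ : _ \o _ = (CRe \o f) \+ (CRe \o g)).
    by move=> x; apply: cvgD; [exact: fr|exact: gr].
  by apply/funext => t; rewrite /= ReD.
rewrite (_ : _ \o _ = (CIm \o f) \+ (CIm \o g)).
  by move=> x; apply: cvgD; [exact: fi|exact: gi].
by apply/funext => t; rewrite /= ImD.
Qed.

Lemma CcontinuousM f g : Ccontinuous f -> Ccontinuous g ->
  Ccontinuous (fun x => f x * g x).
Proof.
move=> [fr fi] [gr gi]; split.
  rewrite (_ : _ \o _ = fun x => CRe (f x) * CRe (g x) - CIm (f x) * CIm (g x)).
    by move=> x; apply: cvgB; apply: cvgM; [exact: fr|exact: gr|exact: fi|exact: gi].
  by apply/funext => t; rewrite /= ReM.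
rewrite (_ : _ \o _ = fun x => CRe (f x) * CIm (g x) + CIm (f x) * CRe (g x)).
  by move=> x; apply: cvgD; apply: cvgM; [exact: fr|exact: gi|exact: fi|exact: gr].
by apply/funext => t; rewrite /= ImM.
Qed.

Lemma CcontinuousJ f : Ccontinuous f -> Ccontinuous (fun x => (f x)^*%C).
Proof.
move=> [fr fi]; split.
  by rewrite (_ : _ \o _ = CRe \o f)//; apply/funext => t; rewrite /= ReJ.
rewrite (_ : _ \o _ = fun x => - CIm (f x)).
  by move=> x; apply: cvgN; exact: fi.
by apply/funext => t; rewrite /= ImJ.
Qed.

Lemma Ccontinuous_cst (c : C) : Ccontinuous (fun=> c).
Proof. by split=> x; exact: cvg_cst. Qed.

End ComplexDerivative.

(** * Vanishing of plane integrals from vanishing of slice integrals *)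

Section Fubini.
Context {R : realType}.
Local Notation leb := (@lebesgue_measure R).
Local Notation leb2 := (leb \x leb)%E.
Local Notation T := (measurableTypeR R).

Lemma integral_mkcond_itv (f : R -> R) (D : set R) (L : R) :
  (forall x, D x -> `|x| <= L) ->
  (\int[leb]_x ((f \_ D) x)%:E =
   \int[leb]_(x in `[(- L)%R, L]) ((f \_ D) x)%:E)%E.
Proof.
move=> DL; rewrite [RHS]integral_mkcond; apply: eq_integral => x _.
rewrite [RHS]patchE; case: ifPn => //; rewrite notin_setE /= in_itv /= -ler_norml => xL.
by rewrite patchE memNset// => /DL.
Qed.

Let mem_slice (U V : Type) (h : U -> V) (D : set V) x :
  (x \in [set x | D (h x)]) = (h x \in D).
Proof. by apply/idP/idP; rewrite !inE. Qed.

(** Fubini with [x] as inner variable. The slice hypothesis is over the segment [[- L, L]] because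
    [integral_derive_pos] works on a compact interval. *)
Lemma Rintegral_fst_slice0 (f : T * T -> R) (D : set (T * T)) (L : R) :
  measurable D -> leb2.-integrable D (EFin \o f) ->
  (forall x y, D (x, y) -> `|x| <= L) ->
  (forall y, (\int[leb]_(x in `[(- L)%R, L]) ((f \_ D) (x, y))%:E = 0)%E) ->
  Rintegral leb2 D f = 0.
Proof.
move=> mD iD DL h.
rewrite Rintegral_mkcond /Rintegral -integral21_prod_meas1.
  rewrite integral0_eq// => y _; rewrite /fubini_G -[RHS](h y).
  rewrite [LHS](_ : _ = \int[leb]_x (((fun x => f (x, y)) \_ [set x | D (x, y)]) x)%:E)%E.
    rewrite (@integral_mkcond_itv _ _ L); last by move=> x /= /DL.
    by apply: eq_integral => x _; rewrite !patchE; congr (if _ then _ else _)%:E; rewrite mem_slice.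
  by apply: eq_integral => x _; rewrite !patchE; congr (if _ then _ else _)%:E; rewrite mem_slice.
have := (integrable_restrict leb2 mD measurableT (EFin \o f)).1.
by rewrite setTI restrict_EFin; exact.
Qed.

Lemma Rintegral_snd_slice0 (f : T * T -> R) (D : set (T * T)) (L : R) :
  measurable D -> leb2.-integrable D (EFin \o f) ->
  (forall x y, D (x, y) -> `|y| <= L) ->
  (forall x, (\int[leb]_(y in `[(- L)%R, L]) ((f \_ D) (x, y))%:E = 0)%E) ->
  Rintegral leb2 D f = 0.
Proof.
move=> mD iD DL h.
rewrite Rintegral_mkcond /Rintegral -integral12_prod_meas1.
  rewrite integral0_eq// => x _; rewrite /fubini_F -[RHS](h x).
  rewrite [LHS](_ : _ = \int[leb]_y (((fun y => f (x, y)) \_ [set y | D (x, y)]) y)%:E)%E.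
    rewrite (@integral_mkcond_itv _ _ L); last by move=> y /= /DL.
    by apply: eq_integral => y _; rewrite !patchE; congr (if _ then _ else _)%:E; rewrite mem_slice.
  by apply: eq_integral => y _; rewrite !patchE; congr (if _ then _ else _)%:E; rewrite mem_slice.
have := (integrable_restrict leb2 mD measurableT (EFin \o f)).1.
by rewrite setTI restrict_EFin; exact.
Qed.

End Fubini.

(** * Green's formula on [{|w| < 1}] for a polynomial [w] *)

Section Green.
Context {R : realType}.
Local Notation C := R[i].
Local Notation CRe := (@complex.Re R).
Local Notation CIm := (@complex.Im R).
Local Notation leb2 := ((@lebesgue_measure R) \x (@lebesgue_measure R))%E.
Local Notation T := (measurableTypeR R).
Local Notation pt xy := (Complex xy.1 xy.2).
Local Notation planar G := [set xy : T * T | G (pt xy)].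

Variables (w : {poly C}) (L : R).
Let G : set C := [set z | cmod w.[z] < 1].
Hypothesis L0 : 0 < L.
Hypothesis bG : forall x y, G (Complex x y) -> `|x| < L /\ `|y| < L.

Let u (z : C) : R := 1 - (CRe w.[z] ^+ 2 + CIm w.[z] ^+ 2).

Let uE (z : C) : (u z)%:C%C = 1 - w.[z] * (w.[z])^*%C.
Proof.
by rewrite /u; case: (w.[z]) => a b; apply: complex_ext => /=; ring.
Qed.

Let G_u z : G z = (0 < u z) :> Prop.
Proof.
rewrite /G /u /= /cmod normc_def /= subr_gt0; congr is_true.
rewrite -[X in _ < X](sqrtr1 R) ltr_sqrt//.
Qed.

Lemma measurable_lemniscate : measurable (planar G).
Proof.
rewrite [X in measurable X](_ : _ =
  (fun xy : T * T => u (pt xy)) @^-1` `]0, +oo[%classic); last first.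
  by apply/seteqP; split=> xy /=; rewrite in_itv/= andbT -G_u.
rewrite -[X in measurable X]setTI.
have [mr mi] := Cmeasurable_horner w.
suff mu : measurable_fun setT (fun xy : T * T => u (pt xy)).
  by apply: mu => //; exact: measurable_itv.
rewrite /u.
apply: measurable_funB; first exact: measurable_cst.
by apply: measurable_funD; exact: measurable_funX.
Qed.

Variables F g : {poly C}.

(* The derivative at [z] in the direction [d] of [(1 - |w|^2) F conj(g)]. *)
Let D (d z : C) : C :=
  - (w^`().[z] * d * (w.[z])^*%C + w.[z] * (w^`().[z] * d)^*%C) * (F.[z] * (g.[z])^*%C)
  + (1 - w.[z] * (w.[z])^*%C) *
    (F^`().[z] * d * (g.[z])^*%C + F.[z] * (g^`().[z] * d)^*%C).

(** Along a line of direction [d], [D d] is the derivative of [u F conj(g)]. The line meets [G] only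
    for [|t| < L], so [u <= 0] at both ends and [integral_derive_pos] applies to each component. *)
Let line_integral0 (gam : R -> C) (d : C) (part : C -> R) :
  is_cderive gam (fun=> d) -> (forall t, G (gam t) -> `|t| < L) ->
  part = CRe \/ part = CIm ->
  (\int[lebesgue_measure]_(t in `[(- L)%R, L])
    (if 0 < u (gam t) then part (D d (gam t)) else 0)%:E = 0)%E.
Proof.
move=> hg bg hpart.
pose dw t := w^`().[gam t] * d * (w.[gam t])^*%C + w.[gam t] * (w^`().[gam t] * d)^*%C.
pose du (t : R) : R := CRe (- dw t).
pose Psi t := F.[gam t] * (g.[gam t])^*%C.
pose dPsi t := F^`().[gam t] * d * (g.[gam t])^*%C + F.[gam t] * (g^`().[gam t] * d)^*%C.
have hw := is_cderive_horner w hg.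
have hu (t : R) : is_derive t 1 (u \o gam) (du t).
  have h := is_cderiveD (is_cderive_cst 1)
    (is_cderiveM (is_cderive_cst (-1)) (is_cderiveM hw (is_cderiveJ hw))).
  have [hr _] := h t.
  rewrite (_ : u \o gam = CRe \o (fun x => 1 + -1 * (w.[gam x] * (w.[gam x])^*%C))).
    by apply: is_derive_eq hr _; rewrite /du mul0r !add0r mulN1r.
  by apply/funext => x; rewrite /= /u; case: (w.[gam x]) => p q /=; ring.
have hPsi : is_cderive Psi dPsi.
  exact: is_cderiveM (is_cderive_horner F hg) (is_cderiveJ (is_cderive_horner g hg)).
have Cc (p : {poly C}) : Ccontinuous (fun t => p.[gam t]).
  exact: is_cderive_continuous (is_cderive_horner p hg).
have Cd : Ccontinuous (fun t : R => d) by exact: Ccontinuous_cst.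
have cdu : continuous du.
  have [hr _] : Ccontinuous (fun t => -1 * dw t).
    apply: CcontinuousM; first exact: Ccontinuous_cst.
    apply: CcontinuousD; apply: CcontinuousM => //;
      try apply: CcontinuousM => //; try apply: CcontinuousJ => //.
    exact: CcontinuousM.
  rewrite (_ : du = CRe \o (fun t => -1 * dw t))//.
  by apply/funext => t; rewrite /= mulN1r.
have cdPsi : Ccontinuous dPsi.
  apply: CcontinuousD; apply: CcontinuousM => //;
      try apply: CcontinuousM => //; try apply: CcontinuousJ => //.
  exact: CcontinuousM.
have DE t : D d (gam t) = (du t)%:C%C * Psi t + (u (gam t))%:C%C * dPsi t.
  rewrite uE /D; congr (_ * _ + _).
  rewrite /du /dw; move: (w^`().[gam t] * d) (w.[gam t]) => [a b] [a' b'].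
  by apply: complex_ext => /=; ring.
have uL t : L <= `|t| -> u (gam t) <= 0.
  move=> Lt; rewrite leNgt; apply/negP => h.
  have /bg : G (gam t) by rewrite G_u.
  by rewrite ltNge Lt.
have LL : - L < L by rewrite gtrN.
have ua : (u \o gam) (- L) <= 0 by apply: uL; rewrite normrN gtr0_norm.
have ub : (u \o gam) L <= 0 by apply: uL; rewrite gtr0_norm.
case: hpart => ->.
  rewrite -[RHS](@integral_derive_pos _ (u \o gam) du (CRe \o Psi) (CRe \o dPsi) (- L) L LL hu
    (fun x => (hPsi x).1) cdu cdPsi.1 ua ub).
  apply: eq_integral => t _; congr (_%:E); rewrite /=; case: ifP => // _.
  by rewrite DE ReD !ReM /= !mul0r !subr0.
rewrite -[RHS](@integral_derive_pos _ (u \o gam) du (CIm \o Psi) (CIm \o dPsi) (- L) L LL hu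
    (fun x => (hPsi x).2) cdu cdPsi.2 ua ub).
apply: eq_integral => t _; congr (_%:E); rewrite /=; case: ifP => // _.
by rewrite DE ImD !ImM /= !mul0r !addr0.
Qed.

Let bG' x y : G (Complex x y) -> `|x| <= L /\ `|y| <= L.
Proof. by move=> /bG[/ltW ? /ltW]. Qed.

Let int_ip p q := area_integrable measurable_lemniscate bG' p q.

Let D_decomp d z : D d z =
  - d * ((w^`() * F).[z] * ((w * g).[z])^*%C) - d^*%C * ((w * F).[z] * ((w^`() * g).[z])^*%C)
  + (d * (F^`().[z] * (g.[z])^*%C) + d^*%C * (F.[z] * ((g^`()).[z])^*%C))
  - (d * ((w * F^`()).[z] * ((w * g).[z])^*%C) + d^*%C * ((w * F).[z] * ((w * g^`()).[z])^*%C)).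
Proof. by rewrite /D !hornerM !conjcM; ring. Qed.

Let D_integrable d : Cintegrable leb2 (planar G) (fun xy => D d (pt xy)).
Proof.
have Z c p q : Cintegrable leb2 (planar G)
    (fun xy => c * (p.[pt xy] * (q.[pt xy])^*%C)).
  exact: (CintegrableZ measurable_lemniscate c (int_ip p q)).
have mG := measurable_lemniscate.
rewrite (_ : (fun xy => _) = fun xy : T * T =>
  (- d * ((w^`() * F).[pt xy] * ((w * g).[pt xy])^*%C)
   + - d^*%C * ((w * F).[pt xy] * ((w^`() * g).[pt xy])^*%C))
  + (d * (F^`().[pt xy] * (g.[pt xy])^*%C)
     + d^*%C * (F.[pt xy] * ((g^`()).[pt xy])^*%C))
  + (- d * ((w * F^`()).[pt xy] * ((w * g).[pt xy])^*%C)
     + - d^*%C * ((w * F).[pt xy] * ((w * g^`()).[pt xy])^*%C))).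
  by do ![apply: (CintegrableD mG)]; exact: Z.
by apply/funext => xy; rewrite D_decomp; ring.
Qed.

(** Horizontal lines serve the direction [1], vertical lines the direction [i]. *)
Let area_D0 : Cintegral leb2 (planar G) (fun xy => D 1 (pt xy)) = 0 /\
  Cintegral leb2 (planar G) (fun xy => D 'i%C (pt xy)) = 0.
Proof.
have mG := measurable_lemniscate.
have hx y : is_cderive (fun t : R => Complex t y) (fun=> 1).
  by move=> t; split; [exact: is_derive_id|exact: is_derive_cst].
have hy x : is_cderive (fun t : R => Complex x t) (fun=> 'i%C).
  by move=> t; split; [exact: is_derive_cst|exact: is_derive_id].
have [ir ii] := D_integrable 1; have [jr ji] := D_integrable 'i%C.
have bx y t : G (Complex t y) -> `|t| < L by move=> /bG[].
have bdy x t : G (Complex x t) -> `|t| < L by move=> /bG[].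
have sl (h : T * T -> R) x y :
    (h \_ (planar G)) (x, y) = if 0 < u (Complex x y) then h (x, y) else 0.
  rewrite patchE; case: ifPn => [|/negP]; rewrite inE /= G_u => h0; first by rewrite h0.
  by case: ifP.
split; apply: complex_ext => /=.
- apply: (Rintegral_fst_slice0 (L := L) mG ir) => [x y /bG'[]//|y].
  rewrite -[RHS](line_integral0 (hx y) (bx y) (or_introl erefl)).
  by apply: eq_integral => t _; rewrite sl.
- apply: (Rintegral_fst_slice0 (L := L) mG ii) => [x y /bG'[]//|y].
  rewrite -[RHS](line_integral0 (hx y) (bx y) (or_intror erefl)).
  by apply: eq_integral => t _; rewrite sl.
- apply: (Rintegral_snd_slice0 (L := L) mG jr) => [x y /bG'[]//|x].
  rewrite -[RHS](line_integral0 (hy x) (bdy x) (or_introl erefl)).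
  by apply: eq_integral => t _; rewrite sl.
- apply: (Rintegral_snd_slice0 (L := L) mG ji) => [x y /bG'[]//|x].
  rewrite -[RHS](line_integral0 (hy x) (bdy x) (or_intror erefl)).
  by apply: eq_integral => t _; rewrite sl.
Qed.

(** The combination [D 1 + i D i] is twice the derivative in [conj(z)] of [(1 - |w|^2) F conj(g)].
    Only the antiholomorphic factors are differentiated, which leaves
    [2 (F conj(g') - w F conj((w g)'))], of integral 0. *)
Lemma area_ip_green : area_ip G (w * F) (w * g)^`() = area_ip G F g^`().
Proof.
have [h1 hi] := area_D0; have mG := measurable_lemniscate.
have i1 := D_integrable 1; have i2 := D_integrable 'i%C.
have : Cintegral leb2 (planar G) (fun xy => D 1 (pt xy) + 'i%C * D 'i%C (pt xy)) = 0.
  rewrite CintegralD//; last exact: CintegrableZ.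
  by rewrite CintegralZ// h1 hi mulr0 addr0.
have -> : (fun xy : T * T => D 1 (pt xy) + 'i%C * D 'i%C (pt xy)) =
  fun xy => 2 * (F.[pt xy] * (g^`().[pt xy])^*%C)
    + -2 * ((w * F).[pt xy] * ((w * g)^`().[pt xy])^*%C).
  apply/funext => xy; rewrite !D_decomp derivM hornerD !hornerM !conjcD !conjcM.
  have ii : 'i%C * 'i%C = -1 :> C by rewrite -expr2 sqr_i.
  have ij : ('i%C)^*%C = - 'i%C :> C by apply: complex_ext => /=; rewrite ?oppr0.
  have j1 : 1^*%C = 1 :> C by exact: conjc1.
  move: ('i%C) ii ij => i ii ij; rewrite ij j1.
  move: (w.[pt xy]) (w.[pt xy])^*%C (w^`().[pt xy]) (w^`().[pt xy])^*%C
    (F.[pt xy]) (F^`().[pt xy]) (g.[pt xy])^*%C (g^`().[pt xy])^*%C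
    => W W' dW dW' f df g' dg'.
  (* Holomorphic derivatives carry the factor [1 + i^2 = 0], antiholomorphic ones the factor
     [1 - i^2 = 2]. *)
  rewrite [LHS](_ : _ = (1 + i * i) * (- (dW * f * (W' * g')) + df * g' - W * df * (W' * g'))
   + (1 - i * i) * (f * dg' - W * f * (dW' * g' + W' * dg'))); last by ring.
  by rewrite ii; ring.
rewrite CintegralD//; [|exact: (CintegrableZ mG _ (int_ip _ _))..].
rewrite !CintegralZ//; [|exact: int_ip..].
rewrite mulNr -mulrBr => /eqP; rewrite mulf_eq0 pnatr_eq0 /= subr_eq0 => /eqP e.
by rewrite /area_ip /area_integral e.
Qed.

End Green.

(** * Rotation invariance *)

Section Rotation.
Context {R : realType}.
Local Notation C := R[i].
Local Notation CRe := (@complex.Re R).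
Local Notation CIm := (@complex.Im R).
Local Notation leb := (@lebesgue_measure R).
Local Notation leb2 := (leb \x leb)%E.
Local Notation T := (measurableTypeR R).
Local Notation planar G := [set xy : T * T | G (Complex xy.1 xy.2)].

Lemma measurable_translation (c : R) : measurable_fun setT (fun y : T => y + c : T).
Proof. by apply: measurable_funD => //; exact: measurable_cst. Qed.

(** By uniqueness of Lebesgue measure it suffices to compare the pushforward with it on half-open
    intervals. *)
Lemma lebesgue_measure_translation (c : R) (A : set T) : measurable A ->
  leb ((fun y : T => y + c) @^-1` A) = leb A.
Proof.
move=> mA; rewrite -[LHS]/(pushforward leb (fun y : T => y + c : T) A).
apply/esym/lebesgue_measure_unique => //=; first exact: measurable_translation.
move=> _ _ [[a b]] _ <-; rewrite /pushforward.
rewrite [X in _ = leb X](_ : _ = `]a - c, b - c]%classic); last first.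
  by apply/seteqP; split=> y /=; rewrite !in_itv /= ltrBlDr lerBrDr.
rewrite !lebesgue_measure_itv /= !lte_fin ltrD2r; case: ifP => // _.
by rewrite -!EFinB opprB addrA subrK.
Qed.

Definition measure_preserving (h : T * T -> T * T) :=
  measurable_fun setT h /\ forall A, measurable A -> leb2 (h @^-1` A) = leb2 A.

Lemma measure_preserving_comp g h : measure_preserving g -> measure_preserving h ->
  measure_preserving (g \o h).
Proof.
move=> [mg pg] [mh ph]; split; first exact: measurableT_comp.
move=> A mA; rewrite comp_preimage ph ?pg//.
by rewrite -[X in measurable X]setTI; exact: mg.
Qed.

Definition shear1 (t : R) (xy : T * T) : T * T := (xy.1, xy.2 + t * xy.1).
Definition shear2 (t : R) (xy : T * T) : T * T := (xy.1 + t * xy.2, xy.2).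

Lemma measurable_shear1 t : measurable_fun setT (shear1 t).
Proof.
apply/measurable_fun_pairP; split; first exact: measurable_fst.
apply: measurable_funD; first exact: measurable_snd.
by apply: measurable_funM; [exact: measurable_cst|exact: measurable_fst].
Qed.

Lemma measurable_shear2 t : measurable_fun setT (shear2 t).
Proof.
apply/measurable_fun_pairP; split; last exact: measurable_snd.
apply: measurable_funD; first exact: measurable_fst.
by apply: measurable_funM; [exact: measurable_cst|exact: measurable_snd].
Qed.

(** The shear translates every vertical slice, so one-dimensional translation invariance suffices
    slice by slice. *)
Lemma shear1_preserving t : measure_preserving (shear1 t).
Proof.
split; first exact: measurable_shear1.
move=> A mA; rewrite /product_measure1; apply: eq_integral => x _ /=.
rewrite -(lebesgue_measure_translation (t * x) (measurable_xsection x mA)).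
by congr (leb _); apply/seteqP; split=> y; rewrite /xsection /= !inE.
Qed.

(** Here horizontal slices are translated, so the product measure is first rewritten with the other
    order of integration. *)
Lemma shear2_preserving t : measure_preserving (shear2 t).
Proof.
split; first exact: measurable_shear2.
have e A : measurable A -> leb2 A = (leb \x^ leb)%E A.
  move=> mA; apply: product_measure_unique => // B D mB mD.
  exact: product_measure2E.
move=> A mA; rewrite !e//; last first.
  by rewrite -[X in measurable X]setTI; exact: measurable_shear2.
rewrite /product_measure2; apply: eq_integral => y _ /=.
rewrite -(lebesgue_measure_translation (t * y) (measurable_ysection y mA)).
by congr (leb _); apply/seteqP; split=> x; rewrite /ysection /= !inE.
Qed.

Definition rotate (c : C) (xy : T * T) : T * T :=
  (CRe c * xy.1 - CIm c * xy.2, CIm c * xy.1 + CRe c * xy.2).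

Lemma rotateE c xy : Complex (rotate c xy).1 (rotate c xy).2 = c * Complex xy.1 xy.2.
Proof. by apply: complex_ext; rewrite ?ReM ?ImM /=; ring. Qed.

(* A rotation with [Im c != 0] is a product of three shears. *)
Lemma rotate_preserving_nonreal c : `|c| = 1 -> CIm c != 0 ->
  measure_preserving (rotate c).
Proof.
case: c => a b c1 /= b0.
have ab : a ^+ 2 + b ^+ 2 = 1.
  have := add_Re2_Im2 (Complex a b); rewrite c1 expr1n => /(congr1 CRe).
  by [].
rewrite (_ : rotate _ = shear2 ((a - 1) / b) \o (shear1 b \o shear2 ((a - 1) / b))).
  apply: measure_preserving_comp; first exact: shear2_preserving.
  by apply: measure_preserving_comp; [exact: shear1_preserving|exact: shear2_preserving].
apply/funext => -[x y]; rewrite /rotate /shear1 /shear2 /=.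
set q := (a - 1) / b.
have bE : b * q = a - 1 by rewrite /q mulrC divfK.
have qE : q * (a + 1) = - b.
  apply: (mulfI b0); rewrite mulrA bE mulrN -expr2.
  rewrite [LHS](_ : _ = a ^+ 2 - 1); last by ring.
  by rewrite -ab; ring.
congr (_, _); last first.
  by rewrite [RHS](_ : _ = b * x + y + b * q * y); [rewrite bE; ring|ring].
rewrite [RHS](_ : _ = x + b * q * x + (b * q - (a - 1)) * q * y + q * (a + 1) * y); last by ring.
by rewrite qE bE; ring.
Qed.

Lemma rotateM c d : rotate (c * d) = rotate c \o rotate d.
Proof.
apply/funext => -[x y]; rewrite /rotate /= ReM ImM.
by congr (_, _); ring.
Qed.

(** The factorization into shears divides by [Im c], so it is applied twice to a square root of [c].
    If that root is real it is [1] or [-1], and [c = 1]. *)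
Lemma rotate_preserving c : `|c| = 1 -> measure_preserving (rotate c).
Proof.
move=> c1.
have h1 : `|sqrtC c| = 1.
  by apply/eqP; rewrite -(@pexpr_eq1 _ _ 2)// -normrX sqrtCK c1.
have [d0|d0] := eqVneq (CIm (sqrtC c)) 0; last first.
  rewrite -(sqrtCK c) expr2 rotateM.
  by apply: measure_preserving_comp; exact: rotate_preserving_nonreal.
have r1 : rotate 1 = id.
  by apply/funext => -[x y]; rewrite /rotate /=; congr (_, _); ring.
suff -> : c = 1 by rewrite r1; split => //; exact: measurable_id.
rewrite -(sqrtCK c); move: (sqrtC c) d0 h1 => -[a b] /= -> h1.
have := add_Re2_Im2 (Complex a 0); rewrite h1 expr1n /= => /(congr1 CRe) /= ab.
by apply: complex_ext => /=; [rewrite -ab; ring|ring].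
Qed.

Lemma area_ip_rotation (G : set C) (L : R) (mG : measurable (planar G))
  (bG : forall x y, G (Complex x y) -> `|x| <= L /\ `|y| <= L)
  (c : C) (f g : {poly C}) : `|c| = 1 -> (forall z, G (c * z) <-> G z) ->
  area_ip G (f \Po (c *: 'X)) (g \Po (c *: 'X)) = area_ip G f g.
Proof.
move=> c1 Gc; have [mr pr] := rotate_preserving c1.
pose F xy := f.[Complex xy.1 xy.2] * (g.[Complex xy.1 xy.2])^*%C.
have [Fm1 Fm2] := CmeasurableM (Cmeasurable_horner f) (CmeasurableJ (Cmeasurable_horner g)).
have Fr xy : F (rotate c xy) =
    (f \Po (c *: 'X)).[Complex xy.1 xy.2] * ((g \Po (c *: 'X)).[Complex xy.1 xy.2])^*%C.
  by rewrite /F rotateE !horner_comp !hornerE.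
have [i1 i2] := area_integrable mG bG (f \Po (c *: 'X)) (g \Po (c *: 'X)).
have preG : rotate c @^-1` planar G = planar G.
  by apply/seteqP; split=> xy; rewrite /preimage /= rotateE => /Gc.
have key (part : C -> R) : measurable_fun setT (part \o F) ->
   leb2.-integrable (planar G) (EFin \o (part \o (fun xy => F (rotate c xy)))) ->
   Rintegral leb2 (planar G) (fun xy => part (F (rotate c xy))) =
   Rintegral leb2 (planar G) (fun xy => part (F xy)).
  move=> mF iF; rewrite /Rintegral; congr fine.
  have iF' : leb2.-integrable (rotate c @^-1` planar G) ((EFin \o (part \o F)) \o rotate c).
    by rewrite preG.
  have e := integral_pushforward mr ((measurable_EFinP _ _).2 mF) iF' mG.
  rewrite preG in e; apply: (eq_trans (esym e)).
  by apply: eq_measure_integral => A mA _; exact: pr.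
have FE : (fun xy => F (rotate c xy)) = fun xy : T * T =>
  (f \Po (c *: 'X)).[Complex xy.1 xy.2] * ((g \Po (c *: 'X)).[Complex xy.1 xy.2])^*%C.
  by apply/funext => xy; rewrite Fr.
rewrite -FE in i1 i2.
rewrite /area_ip /area_integral; apply: complex_ext => /=.
  under eq_Rintegral do rewrite -Fr.
  exact: (key CRe).
under eq_Rintegral do rewrite -Fr.
exact: (key CIm).
Qed.

(** Rotating multiplies the inner product by [c^a conj(c^b)]. As [|c| = 1], this factor is 1 only if
    [c^a = c^b]. *)
Lemma area_ip_rotation_orthogonal (G : set C) (L : R) (mG : measurable (planar G))
  (bG : forall x y, G (Complex x y) -> `|x| <= L /\ `|y| <= L)
  (c : C) (a b : nat) (f g : {poly C}) : `|c| = 1 -> (forall z, G (c * z) <-> G z) ->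
  f \Po (c *: 'X) = c ^+ a *: f -> g \Po (c *: 'X) = c ^+ b *: g ->
  c ^+ a != c ^+ b -> area_ip G f g = 0.
Proof.
move=> c1 Gc fc gc ab.
have := area_ip_rotation mG bG f g c1 Gc.
rewrite fc gc (area_ipZl mG bG) (area_ipZr mG bG) mulrA => /eqP.
rewrite -subr_eq0 -{2}[area_ip G f g]mul1r -mulrBl mulf_eq0 => /orP[|/eqP//].
have cb : c ^+ b * (c ^+ b)^*%C = 1 by rewrite -sqr_normc normrX c1 !expr1n.
rewrite subr_eq0 => /eqP e; move: ab.
by rewrite -[c ^+ a]mulr1 -cb [c ^+ b * _]mulrC mulrA e mul1r eqxx.
Qed.

End Rotation.

(** * Moments on the circle *)

Section CircleInnerProduct.
Context {R : realType}.
Local Notation C := R[i].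
Local Notation CRe := (@complex.Re R).
Local Notation CIm := (@complex.Im R).
Local Notation leb := (@lebesgue_measure R).
Local Notation T := (measurableTypeR R).

Lemma continuous_Cintegrable (f : R -> C) (a b : R) : Ccontinuous f ->
  Cintegrable leb (`[a, b]%classic : set T) f.
Proof.
by move=> [fr fi]; split; apply: continuous_compact_integrable;
  first [exact: segment_compact | exact: continuous_subspaceT].
Qed.

Lemma Cintegral_FTC (F f : R -> C) (a b : R) : a < b -> is_cderive F f ->
  Ccontinuous f -> Cintegral leb (`[a, b]%classic : set T) f = F b - F a.
Proof.
move=> ab dF [fr fi]; apply: complex_ext.
  rewrite /= (Rintegral_FTC ab (fun x => (dF x).1) fr).
  by rewrite /comp; case: (F a) (F b) => [? ?] [? ?].
rewrite /= (Rintegral_FTC ab (fun x => (dF x).2) fi).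
by rewrite /comp; case: (F a) (F b) => [? ?] [? ?].
Qed.

Definition cis (t : R) : C := Complex (cos t) (sin t).

Lemma cis_conj t : cis t * (cis t)^*%C = 1.
Proof.
apply: complex_ext; rewrite ?ReM ?ImM /=; last by ring.
by rewrite -[RHS](cos2Dsin2 t); ring.
Qed.

Lemma is_cderive_cis : is_cderive cis (fun t => 'i%C * cis t).
Proof.
move=> t; split; rewrite ?ReM ?ImM /=.
  by apply: is_derive_eq (is_derive_cos t) _; ring.
by apply: is_derive_eq (is_derive_sin t) _; ring.
Qed.

Variables (rho sigma : R) (h : C -> R).
Hypotheses (rho0 : 0 < rho) (rho1 : rho < 1) (sigma1 : sigma < 1).

(** This is [|1 + rho e^(it)|^2], so [hE] below says that the weight is
    [|1 + rho w|^(2 sigma - 2)]. *)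
Let v (t : R) : R := 1 + rho ^+ 2 + 2 * rho * cos t.
Let v_ge t : (1 - rho) ^+ 2 <= v t.
Proof.
rewrite /v; have : 0 <= 2 * rho * (1 + cos t).
  by have := cos_geN1 t => ?; apply: mulr_ge0; [apply: mulr_ge0 => //; exact: ltW|lra].
by move=> ?; nra.
Qed.

Lemma sqr_one_plus_rho_cis_gt0 t : 0 < 1 + rho ^+ 2 + 2 * rho * cos t.
Proof. by apply: lt_le_trans (v_ge t); rewrite exprn_gt0// subr_gt0. Qed.

Hypothesis hE : forall t, h (cis t) = v t `^ (sigma - 1).

Let v_gt0 t : 0 < v t. Proof. exact: sqr_one_plus_rho_cis_gt0. Qed.

Let vE t : (v t)%:C%C = 1 + rho%:C%C ^+ 2 + rho%:C%C * (cis t + (cis t)^*%C).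
Proof. by rewrite /v; apply: complex_ext => /=; ring. Qed.

Let is_derive_v (t : R) : is_derive t 1 v (- (2 * rho * sin t)).
Proof.
rewrite (_ : v = cst (1 + rho ^+ 2) + cst (2 * rho) * cos)//.
have hc := is_deriveM (is_derive_cst (2 * rho) t (1 : R)) (is_derive_cos t).
have := is_deriveD (is_derive_cst (1 + rho ^+ 2) t (1 : R)) hc.
by move/is_derive_eq; apply; rewrite /GRing.scale /=; ring.
Qed.

Let is_derive_vpow (a t : R) :
  is_derive t 1 (fun t => v t `^ a) (a * v t `^ (a - 1) * - (2 * rho * sin t)).
Proof. exact: (is_derive1_comp (is_derive1_powR a (v_gt0 t)) (is_derive_v t)). Qed.

Let W t : R := v t `^ (sigma - 1).

Let cW : Ccontinuous (fun t => (W t)%:C%C).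
Proof.
split; first exact: derive_continuous (is_derive_vpow (sigma - 1)).
by move=> t; exact: cvg_cst.
Qed.

Let Chorner (p : {poly C}) : Ccontinuous (fun t => p.[cis t]).
Proof. exact: is_cderive_continuous (is_cderive_horner p is_cderive_cis). Qed.

Let cip p q : Ccontinuous (fun t => p.[cis t] * (q.[cis t])^*%C * (W t)%:C%C).
Proof.
apply: CcontinuousM => //; apply: CcontinuousM => //; exact: CcontinuousJ.
Qed.

Let mI : measurable (`[0, 2 * pi]%classic : set T). Proof. exact: measurable_itv. Qed.

Lemma circle_ipE p q : circle_ip h p q =
  Cintegral leb (`[0, 2 * pi]%classic : set T) (fun t => p.[cis t] * (q.[cis t])^*%C * (W t)%:C%C).
Proof.
rewrite /circle_ip /circle_integral; apply: eq_Cintegral => t _.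
by rewrite -/(cis t) hE.
Qed.

Let iip p q : Cintegrable leb (`[0, 2 * pi]%classic : set T)
  (fun t => p.[cis t] * (q.[cis t])^*%C * (W t)%:C%C).
Proof. exact: continuous_Cintegrable. Qed.

Lemma circle_ipDl f g q : circle_ip h (f + g) q = circle_ip h f q + circle_ip h g q.
Proof.
rewrite !circle_ipE -CintegralD//.
by apply: eq_Cintegral => t _; rewrite hornerD; ring.
Qed.

Lemma circle_ipZl (c : C) f q : circle_ip h (c *: f) q = c * circle_ip h f q.
Proof.
rewrite !circle_ipE -CintegralZ//.
by apply: eq_Cintegral => t _; rewrite hornerZ; ring.
Qed.

Lemma circle_ip_conj f q : (circle_ip h f q)^*%C = circle_ip h q f.
Proof.
rewrite !circle_ipE -Cintegral_conj//.
by apply: eq_Cintegral => t _; rewrite !conjcM conjcK conjc_real; ring.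
Qed.

Lemma circle_ipDr f g q : circle_ip h q (f + g) = circle_ip h q f + circle_ip h q g.
Proof. by rewrite -circle_ip_conj circle_ipDl conjcD !circle_ip_conj. Qed.

Lemma circle_ipZr (c : C) f q : circle_ip h q (c *: f) = c^*%C * circle_ip h q f.
Proof. by rewrite -circle_ip_conj circle_ipZl conjcM circle_ip_conj. Qed.

(** Multiplication by [w] is isometric on [|w| = 1]: the moment matrix is Toeplitz, like the area
    moments [E]. *)
Lemma circle_ip_shift f q : circle_ip h ('X * f) ('X * q) = circle_ip h f q.
Proof.
rewrite !circle_ipE; apply: eq_Cintegral => t _.
rewrite !hornerM !hornerX conjcM; congr (_ * _).
by rewrite mulrACA cis_conj mul1r.
Qed.

Definition circle_moment (n : nat) : C := circle_ip h 'X^n 1.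

Lemma circle_moment_bounded : exists B : R, forall n, cmod (circle_moment n) <= B.
Proof.
(* An upper bound of the weight: [v >= (1 - rho)^2] and the exponent [sigma - 1] is negative. *)
pose B := (`|(1 - rho) ^+ 2| `^ (sigma - 1)).
have fin : (leb (`[0%R, (2 * pi)%R]%classic : set R) < +oo)%E.
  by rewrite lebesgue_measure_itv /=; case: ifP; rewrite -?EFinB ltry.
exists (2 * (2 * (1 * B) * fine (leb (`[0, 2 * pi]%classic : set R)))) => n.
rewrite /circle_moment circle_ipE.
apply: (Cbounded_Cintegral mI fin) => //.
apply: CboundedM.
  move=> t _; rewrite hornerXn hornerC conjc1 mulr1.
  have : cmod (cis t ^+ n) = 1.
    rewrite /cmod normrX (_ : `|cis t| = 1) ?expr1n//.
    by apply/eqP; rewrite -(@pexpr_eq1 _ _ 2)// sqr_normc cis_conj.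
  rewrite /cmod; case: (cis t ^+ n) => a b; rewrite normc_def /= => ab1.
  have {ab1} ab : a ^+ 2 + b ^+ 2 = 1.
    by rewrite -[LHS]sqr_sqrtr ?addr_ge0 ?sqr_ge0// ab1 expr1n.
  by split; rewrite -(@expr_le1 _ 2)// real_normK ?num_real// -ab ?lerDl ?lerDr sqr_ge0.
move=> t _; rewrite /= normr0; split; last exact: powR_ge0.
rewrite ger0_norm ?powR_ge0// /W /B.
have v1 : `|(1 - rho) ^+ 2| <= v t.
  by rewrite ger0_norm ?sqr_ge0.
rewrite -(opprB 1 sigma) !powRN lef_pV2 ?posrE ?powR_gt0//; last first.
  by rewrite normr_gt0 expf_neq0// gt_eqF// subr_gt0.
by apply: ge0_ler_powR => //; rewrite ?nnegrE ?subr_ge0 ?normr_ge0// ltW.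
Qed.

Lemma circle_moment0_neq0 : circle_moment 0 != 0.
Proof.
suff : 0 < CRe (circle_moment 0).
  by apply: contraTneq => ->; rewrite /= ltxx.
rewrite /circle_moment circle_ipE /=.
(* A positive lower bound of the weight, from [v <= 4]. *)
pose d := (4 `^ (1 - sigma))^-1 : R.
have d0 : 0 < d by rewrite invr_gt0 powR_gt0.
have Wd t : d <= W t.
  rewrite /d /W -(opprB 1 sigma) powRN lef_pV2 ?posrE ?powR_gt0//.
  apply: ge0_ler_powR; rewrite ?nnegrE ?subr_ge0 ?(ltW sigma1) ?(ltW (v_gt0 t))//.
  have : 0 <= 2 * rho * (1 - cos t).
    by apply: mulr_ge0; [apply: mulr_ge0 => //; exact: ltW|rewrite subr_ge0 cos_le1].
  have : 0 <= (1 - rho) * (3 + rho).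
    by apply: mulr_ge0; [rewrite subr_ge0 ltW|apply: addr_ge0 => //; exact: ltW].
  by rewrite /v => ? ?; lra.
have e : {in (`[0, 2 * pi]%classic : set T),
    (fun t => CRe (('X^0).[cis t] * ((1 : {poly C}).[cis t])^*%C * (W t)%:C%C)) =1 W}.
  by move=> t _; rewrite expr0 hornerC conjc1 !mul1r.
rewrite (eq_Rintegral _ e).
have cint (f : R -> R) : continuous f ->
    leb.-integrable (`[0, 2 * pi]%classic : set T) (EFin \o f).
  move=> cf; apply: continuous_compact_integrable; first exact: segment_compact.
  exact: continuous_subspaceT.
have pi2 : (0 : R) < 2 * pi by rewrite mulr_gt0// pi_gt0.
apply: (@lt_le_trans _ _ (Rintegral leb (`[0, 2 * pi]%classic : set T) (cst d))).
  have lI : fine (leb (`[0, 2 * pi]%classic : set R)) = 2 * pi.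
    by rewrite lebesgue_measure_itv /= lte_fin pi2 -EFinB subr0.
  rewrite Rintegral_cst//; apply: mulr_gt0 => //.
  exact: (eq_ind _ (fun x => 0 < x) pi2 _ (esym lI)).
apply: le_Rintegral => //; apply: cint; last exact: cW.1.
by move=> x; exact: cvg_cst.
Qed.

(** The derivative of [v^sigma e^(i(n+1)t)] integrates to 0 over a period. It equals [v^(sigma - 1)]
    times a combination of [e^(ikt)] for [k = n, n+1, n+2], because [v] and [v'] are combinations of
    1, [e^(it)] and [e^(-it)]. *)
Lemma circle_moment_rec n :
  (n.+1%:R + sigma%:C%C) * rho%:C%C * circle_moment n.+2
  + n.+1%:R * (1 + rho%:C%C ^+ 2) * circle_moment n.+1
  + (n.+1%:R - sigma%:C%C) * rho%:C%C * circle_moment n = 0.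
Proof.
have pi2 : (0 : R) < 2 * pi by rewrite mulr_gt0// pi_gt0.
pose F t := (v t `^ sigma)%:C%C * ('X^(n.+1)).[cis t].
pose f t := (sigma * W t * - (2 * rho * sin t))%:C%C * ('X^(n.+1)).[cis t]
  + (v t `^ sigma)%:C%C * (('X^(n.+1))^`().[cis t] * ('i%C * cis t)).
have dF : is_cderive F f.
  apply: is_cderiveM; last exact: is_cderive_horner is_cderive_cis.
  move=> t; split; first exact: is_derive_vpow.
  exact: is_derive_cst.
pose cip1 k t := ('X^k).[cis t] * ((1 : {poly C}).[cis t])^*%C * (W t)%:C%C.
pose G t := ('i%C * ((n.+1%:R + sigma%:C%C) * rho%:C%C)) * cip1 n.+2 t
  + (('i%C * (n.+1%:R * (1 + rho%:C%C ^+ 2))) * cip1 n.+1 t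
  + ('i%C * ((n.+1%:R - sigma%:C%C) * rho%:C%C)) * cip1 n t).
have fE : f = G.
  apply/funext => t.
  have vW : v t `^ sigma = v t * W t.
    rewrite /W -{2}(powRr1 (ltW (v_gt0 t))) -powRD; last by rewrite (gt_eqF (v_gt0 t)) implybT.
    by congr (_ `^ _); ring.
  have sE : (- (2 * rho * sin t))%:C%C = 'i%C * rho%:C%C * (cis t - (cis t)^*%C).
    by apply: complex_ext => /=; ring.
  rewrite /f /G /cip1 vW !rmorphM /= sE vE derivXn hornerMn !hornerXn hornerC conjc1.
  have := cis_conj t; move: (cis t) (cis t)^*%C => z z' zz'.
  have zn k : z ^+ k.+1 * z' = z ^+ k by rewrite exprSr -mulrA zz' mulr1.
  rewrite [LHS](_ : _ = 'i%C * (W t)%:C%C * (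
       sigma%:C%C * rho%:C%C * (z * z ^+ n.+1 - z ^+ n.+1 * z')
     + n.+1%:R * (1 + rho%:C%C ^+ 2) * (z ^+ n * z)
     + n.+1%:R * rho%:C%C * (z * (z ^+ n * z) + z ^+ n * (z * z')))).
    by rewrite zn zz' -!exprS -!exprSr -exprS; ring.
  by rewrite /= -mulr_natr; ring.
have cf : Ccontinuous f.
  have cZ c k : Ccontinuous (fun t => c * cip1 k t).
    by apply: CcontinuousM; [exact: Ccontinuous_cst|exact: cip].
  rewrite fE.
  exact: CcontinuousD (cZ _ _) (CcontinuousD (cZ _ _) (cZ _ _)).
have := Cintegral_FTC pi2 dF cf.
rewrite /F (_ : cis (2 * pi) = cis 0); last first.
  by rewrite /cis mulr_natl cos2pi sin2pi cos0 sin0.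
rewrite (_ : v (2 * pi) = v 0); last by rewrite /v [2 * pi]mulr_natl cos2pi cos0.
rewrite subrr fE.
have iZ c k : Cintegrable leb (`[0, 2 * pi]%classic : set T) (fun t => c * cip1 k t).
  exact: (CintegrableZ mI c (iip _ _)).
rewrite (CintegralD mI (iZ _ _) (CintegrableD mI (iZ _ _) (iZ _ _))).
rewrite (CintegralD mI (iZ _ _) (iZ _ _)) !(CintegralZ mI _ (iip _ _)).
rewrite /circle_moment !circle_ipE -/(cip1 _) => H.
have i0 : 'i%C != 0 :> C.
  by apply/eqP => /(congr1 CIm) /= /eqP; rewrite oner_eq0.
apply: (mulfI i0); rewrite mulr0 -[RHS]H; ring.
Qed.

End CircleInnerProduct.

(** * Elementary properties of the real-valued modulus *)

Section Modulus.
Context {R : realType}.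
Local Notation C := R[i].

Lemma cmodE (z : C) : `|z| = (cmod z)%:C%C.
Proof. by rewrite /cmod normc_def. Qed.

Lemma cmod_ge0 (z : C) : 0 <= cmod z.
Proof. by have := normr_ge0 z; rewrite cmodE ler0c. Qed.

Lemma cmodM (z t : C) : cmod (z * t) = cmod z * cmod t.
Proof. by apply: complexI; rewrite -cmodE normrM !cmodE -rmorphM. Qed.

Lemma cmodD (z t : C) : cmod (z + t) <= cmod z + cmod t.
Proof. by rewrite -lecR rmorphD /= -!cmodE ler_normD. Qed.

Lemma cmodN (z : C) : cmod (- z) = cmod z.
Proof. by rewrite /cmod normrN. Qed.

Lemma cmodB (z t : C) : cmod (z - t) <= cmod z + cmod t.
Proof. by rewrite -(cmodN t) cmodD. Qed.

Lemma cmod_real (x : R) : 0 <= x -> cmod x%:C%C = x.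
Proof. by move=> x0; rewrite /cmod ger0_norm// ler0c. Qed.

Lemma cmod_eq0 (z : C) : cmod z = 0 -> z = 0.
Proof. by move=> z0; apply/eqP; rewrite -normr_eq0 cmodE z0. Qed.

Lemma Re_le_cmod (z : C) : `|complex.Re z| <= cmod z.
Proof. by case: z => a b; rewrite /cmod normc_def /= -sqrtr_sqr ler_wsqrtr// lerDl sqr_ge0. Qed.

Lemma Im_le_cmod (z : C) : `|complex.Im z| <= cmod z.
Proof. by case: z => a b; rewrite /cmod normc_def /= -sqrtr_sqr ler_wsqrtr// lerDr sqr_ge0. Qed.

Lemma cmodX (z : C) n : cmod (z ^+ n) = cmod z ^+ n.
Proof. by apply: complexI; rewrite -cmodE normrX cmodE rmorphXn. Qed.

End Modulus.

(** * Bounded solutions of the three-term recurrence *)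

Section Recurrence.
Context {R : realType}.
Local Notation C := R[i].
Variables (rho sigma : R).
Hypotheses (rho0 : 0 < rho) (rho1 : rho < 1) (sigma0 : 0 < sigma) (sigma1 : sigma < 1).

Definition satisfies_rec (d : nat -> C) := forall n,
  (n.+1%:R + sigma%:C%C) * rho%:C%C * d n.+2
  + n.+1%:R * (1 + rho%:C%C ^+ 2) * d n.+1
  + (n.+1%:R - sigma%:C%C) * rho%:C%C * d n = 0.

Lemma rec_unique (d : nat -> C) : satisfies_rec d -> d 0 = 0 -> d 1 = 0 ->
  forall n, d n = 0.
Proof.
move=> hd d0 d1 n; suff [] : d n = 0 /\ d n.+1 = 0 by [].
elim: n => [//|n [h0 h1]]; split=> //.
have := hd n; rewrite h0 h1 !mulr0 !addr0 => /eqP.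
rewrite mulf_eq0 => /orP[|/eqP//].
have -> : (n.+1%:R + sigma%:C%C) * rho%:C%C = ((n.+1%:R + sigma) * rho)%:C%C :> C.
  by rewrite rmorphM rmorphD /= rmorph_nat.
move=> /eqP/(congr1 (@complex.Re R)) /= /eqP.
by rewrite gt_eqF// mulr_gt0// addr_gt0.
Qed.

(* The dominant solution grows geometrically, so the bounded solutions form a line. *)
Lemma bounded_rec_eq0 (d : nat -> C) (B : R) : satisfies_rec d -> d 0 = 0 ->
  (forall n, cmod (d n) <= B) -> forall n, d n = 0.
Proof.
move=> hd d0 dB; apply: rec_unique => //; apply: cmod_eq0.
(* If [|d|] does not decrease from [n] to [n+1], the recurrence forces the next ratio to be at least
   [1 + del]. For large [n] this argument gives nearly [1 + (1 - rho)^2 / rho]; half of that gain is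
   available for every [n] because [sigma <= n+1]. *)
pose a n := cmod (d n); pose del := (1 - rho) ^+ 2 / (2 * rho).
have del0 : 0 < del.
  by apply: divr_gt0; [rewrite exprn_gt0// subr_gt0|exact: mulr_gt0].
have a_ge0 n : 0 <= a n by exact: cmod_ge0.
have rec_a n : n.+1%:R * (1 + rho ^+ 2) * a n.+1 <=
    (n.+1%:R + sigma) * rho * a n.+2 + (n.+1%:R - sigma) * rho * a n.
  have n1 : (1 : R) <= n.+1%:R by rewrite ler1n.
  have c1 : 0 <= n.+1%:R * (1 + rho ^+ 2).
    by apply: mulr_ge0 => //; apply: addr_ge0 => //; exact: sqr_ge0.
  have c2 : 0 <= (n.+1%:R + sigma) * rho.
    by apply: mulr_ge0 (ltW rho0); apply: addr_ge0 => //; exact: ltW.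
  have s1 : 0 <= n.+1%:R - sigma by rewrite subr_ge0 (le_trans (ltW sigma1)).
  have c3 : 0 <= (n.+1%:R - sigma) * rho by exact: mulr_ge0 (ltW rho0).
  rewrite /a -(cmod_real c1) -(cmod_real c2) -(cmod_real c3) -!cmodM.
  rewrite -cmodN; apply: le_trans (cmodD _ _); rewrite le_eqVlt; apply/orP; left.
  apply/eqP; congr cmod; apply/eqP; rewrite eqr_oppLR -subr_eq0 opprK -[X in _ == X](hd n).
  by apply/eqP; rewrite !(rmorphM, rmorphD, rmorphN, rmorphXn, rmorph1) /= !rmorph_nat; ring.
have key n : a n <= a n.+1 /\ a 1 * (1 + n%:R * del) <= a n.+1.
  elim: n => [|n [IH1 IH2]].
    by rewrite mul0r addr0 mulr1 {1}/a d0 (cmod_real (lexx 0)).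
  have n1 : (1 : R) <= n.+1%:R by rewrite ler1n.
  have s1 : 0 <= n.+1%:R - sigma by rewrite subr_ge0 (le_trans (ltW sigma1)).
  have h : n.+1%:R * (1 + rho ^+ 2) * a n.+1 <=
    (n.+1%:R + sigma) * rho * a n.+2 + (n.+1%:R - sigma) * rho * a n.+1.
    apply: (le_trans (rec_a n)); rewrite lerD2l; apply: ler_wpM2l => //.
    exact: mulr_ge0 (ltW rho0).
  have g : (1 + del) * a n.+1 <= a n.+2.
    have pos : 0 < (n.+1%:R + sigma) * (2 * rho).
      by apply: mulr_gt0; [exact: addr_gt0|exact: mulr_gt0].
    rewrite -(ler_pM2l pos).
    have -> : (n.+1%:R + sigma) * (2 * rho) * ((1 + del) * a n.+1) =
      (n.+1%:R + sigma) * (2 * rho + (1 - rho) ^+ 2) * a n.+1.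
      by rewrite /del; field; rewrite gt_eqF.
    have : 0 <= (n.+1%:R - sigma) * (1 - rho) ^+ 2 * a n.+1.
      by apply: mulr_ge0 => //; apply: mulr_ge0 => //; exact: sqr_ge0.
    by nra.
  have d1 : 0 <= del * a n.+1 by rewrite mulr_ge0// ltW.
  split; first by lra.
  rewrite -natr1.
  have a1 : a 1 <= a n.+1.
    by apply: le_trans IH2; rewrite ler_peMr// lerDl mulr_ge0// ltW.
  have : del * a 1 <= del * a n.+1 by rewrite ler_pM2l.
  by lra.
(* A positive [a 1] would make the linear lower bound in [key] exceed [B]. *)
apply/eqP; rewrite eq_le a_ge0 andbT leNgt; apply/negP => a1.
have B0 : 0 <= B := le_trans (a_ge0 0) (dB 0).
have ad : 0 < a 1 * del by exact: mulr_gt0.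
have := archi_boundP (divr_ge0 B0 (ltW ad)).
set N := Num.bound _ => hN.
have := le_trans (key N).2 (dB _).
move: hN; rewrite ltr_pdivrMr// => hN.
by lra.
Qed.

End Recurrence.

(** * The lemniscate *)

Section Lemniscate.
Context {R : realType}.
Local Notation C := R[i].
Local Notation T := (measurableTypeR R).
Local Notation planar G := [set xy : T * T | G (Complex xy.1 xy.2)].
Variables (m : nat) (r : R).
Hypotheses (m2 : (2 <= m)%N) (r0 : 0 < r) (r1 : r < 1).

Let rho : R := r ^+ m.
Let m0 : (0 < m)%N. Proof. exact: leq_trans m2. Qed.
Let rho0 : 0 < rho. Proof. exact: exprn_gt0. Qed.
Let rho1 : rho < 1. Proof. by rewrite exprn_ilt1 ?ltW// -lt0n. Qed.
Let crho0 : rho%:C%C != 0 :> C.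
Proof. by apply/eqP => /(congr1 (@complex.Re R)) /= /eqP; rewrite gt_eqF. Qed.

Definition lemniscate_coord : {poly C} := (rho%:C%C)^-1 *: ('X^m - 1).
Local Notation w := lemniscate_coord.
Local Notation G := (lemniscate m r).
Let G' : set C := [set z | cmod w.[z] < 1].

Let GE : G = G'.
Proof.
apply/seteqP; split=> z; rewrite /G' /lemniscate /= !hornerE.
  all: rewrite cmodM -fmorphV cmod_real ?invr_ge0 ?ltW// mulrC ltr_pdivrMr// mul1r.
  all: by [].
Qed.

(** If [|z| >= 2] then [|z^m| >= 2], whereas [|z^m| < 1 + rho < 2] on [G]. *)
Let bG' x y : G' (Complex x y) -> `|x| < 2 /\ `|y| < 2.
Proof.
rewrite -GE /lemniscate /= => zlt.
suff : cmod (Complex x y) < 2.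
  have h (t : R) : t ^+ 2 <= x ^+ 2 + y ^+ 2 -> `|t| <= cmod (Complex x y).
    by move=> ht; rewrite /cmod normc_def /= -sqrtr_sqr ler_wsqrtr.
  by move=> lt2; split; apply: le_lt_trans lt2; apply: h; rewrite ?lerDl ?lerDr sqr_ge0.
move: (Complex x y) zlt => z zlt; rewrite ltNge; apply/negP => z2.
have zm : 2 <= cmod (z ^+ m).
  rewrite cmodX; apply: (le_trans z2); rewrite -[leLHS]expr1 ler_weXn2l//.
  by apply: le_trans z2; rewrite ler1n.
have : cmod (z ^+ m) <= cmod (z ^+ m - 1) + cmod 1.
  by rewrite -{1}[z ^+ m](subrK 1) cmodD.
rewrite (_ : cmod 1 = 1); last exact: (cmod_real (x := 1)).
by move: zlt rho1; rewrite -/rho; lra.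
Qed.

Lemma measurable_planar_lemniscate : measurable (planar (lemniscate m r)).
Proof. by rewrite GE; exact: measurable_lemniscate. Qed.
Let mG := measurable_planar_lemniscate.

Lemma lemniscate_bounded x y : lemniscate m r (Complex x y) -> `|x| <= 2 /\ `|y| <= 2.
Proof. by rewrite GE => /bG'[/ltW ? /ltW]. Qed.
Let bG := lemniscate_bounded.

Local Notation ip := (area_ip G).
Let ipDl := area_ipDl mG bG.
Let ipDr := area_ipDr mG bG.
Let ipZl := area_ipZl mG bG.
Let ipZr := area_ipZr mG bG.
Let ipJ := area_ip_conj mG bG.

Lemma lemniscate_green (F g : {poly C}) : ip (w * F) (w * g)^`() = ip F g^`().
Proof. by rewrite GE; apply: (@area_ip_green _ w 2) => //; exact: bG'. Qed.

Let dw : w^`() = ((rho%:C%C)^-1 * m%:R) *: 'X^(m.-1).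
Proof. by rewrite /lemniscate_coord derivZ derivB derivXn derivC subr0 -scalerA scaler_nat. Qed.

Let Xm : 'X^m = 1 + rho%:C%C *: w.
Proof. by rewrite /lemniscate_coord scalerA mulfV// scale1r addrC subrK. Qed.

(** Green's formula for the pair [f'], [g] and, conjugated, for [g'], [f] gives two expressions for
    [<f', g'>]. Cancelling their common term [<w f', w g'>] leaves [<w f', w' g> = <w' f, w g'>], to
    which [<w' f, w' g>] is added. *)
Lemma lemniscate_rotation_symmetry (f g : {poly C}) :
  ip (w^`() * f) (w * g)^`() = ip (w * f)^`() (w^`() * g).
Proof.
have e1 := lemniscate_green f^`() g.
have e2 : ip (w * f)^`() (w * g^`()) = ip f^`() g^`().
  by rewrite -ipJ lemniscate_green ipJ.
move: e1 e2; rewrite !derivM !ipDl !ipDr => e1 e2.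
congr (_ + _); apply: (addIr (area_ip G (w * f^`()) (w * g^`()))).
by rewrite e2 e1.
Qed.

(** * Area moments for exponents congruent to [s] modulo [m], with [s < m - 1] *)

Section Sector.
Variable s : nat.
Hypothesis sm : (s.+1 < m)%N.

Let sigma : R := s.+1%:R / m%:R.
Let sigma0 : 0 < sigma. Proof. by rewrite divr_gt0// ltr0n. Qed.
Let sigma1 : sigma < 1.
Proof. by rewrite ltr_pdivrMr ?ltr0n// mul1r ltr_nat. Qed.
Let cm0 : m%:R != 0 :> C. Proof. by rewrite pnatr_eq0 -lt0n. Qed.
Let csigma : sigma%:C%C = s.+1%:R / m%:R :> C.
Proof. by rewrite /sigma rmorphM fmorphV !rmorph_nat. Qed.

Definition sector_form (f g : {poly C}) : C :=
  ip ('X^s * (f \Po w)) ('X^(s.+1) * (g \Po w))^`().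

Let E (a b : nat) : C := ip ('X^s * w ^+ a) ('X^(s.+1) * w ^+ b)^`().

(** Since [w' = (m / rho) z^(m-1)], one has [z w' = (m / rho) z^m = (m / rho) (1 + rho w)]: the
    result stays in [z^s] times polynomials in [w]. *)
Let dwE f : w^`() * ('X^(s.+1) * f) = (m%:R / rho%:C%C) *: ('X^s * (1 + rho%:C%C *: w) * f).
Proof.
have -> : 'X^s * (1 + rho%:C%C *: w) = 'X^(s.+1) * 'X^(m.-1).
  by rewrite -Xm -!exprD; congr ('X^_); rewrite addSn -addnS prednK.
by rewrite dw [m%:R / _]mulrC -!scalerAl mulrA ['X^(m.-1) * _]mulrC.
Qed.

Let deriv_sector b : ('X^(s.+1) * w ^+ b)^`() =
  m%:R *: ((sigma%:C%C + b%:R) *: ('X^s * w ^+ b) + (b%:R / rho%:C%C) *: ('X^s * w ^+ b.-1)).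
Proof.
have h1 : m%:R * sigma%:C%C = s.+1%:R :> C by rewrite csigma mulrC divfK.
rewrite derivM derivXn deriv_exp /=.
case: b => [|b].
  rewrite expr0 mulr0n mulr0 addr0 mulr1 mul0r scale0r !addr0 scalerA h1.
  by rewrite mulr1 scaler_nat.
have -> : 'X^(s.+1) * (w^`() * w ^+ b *+ b.+1) = (w^`() * ('X^(s.+1) * w ^+ b)) *+ b.+1.
  by rewrite mulrnAr mulrCA.
rewrite dwE exprS /= [RHS]scalerDr; move: lemniscate_coord => u.
rewrite !scalerA [m%:R * (_ + _)]mulrDr h1 -!mul_polyC.
have r1' : (rho%:C%C)%:P * ((rho%:C%C)^-1)%:P = 1 :> {poly C}.
  by rewrite -polyCM mulfV.
rewrite !polyCD !polyCM !polyC_natr -(mulr_natr 'X^s) -[_ *+ b.+1]mulr_natr.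
set A := u ^+ b; set B := 'X^s; set p := (rho%:C%C)%:P; set p' := (_^-1)%:P.
rewrite [LHS](_ : _ = B * s.+1%:R * u * A + m%:R * p' * B * A * b.+1%:R
  + (p * p') * (m%:R * B * u * A * b.+1%:R)); last by ring.
by rewrite r1'; ring.
Qed.

Let E_shift a b : E a.+1 b.+1 = E a b.
Proof.
rewrite /E -(lemniscate_green ('X^s * w ^+ a) ('X^(s.+1) * w ^+ b)).
by rewrite !(exprS w) ['X^s * _]mulrCA ['X^(s.+1) * _]mulrCA.
Qed.

(** This is [lemniscate_rotation_symmetry] for [z^(s+1) w^a] and [z^(s+1) w^b], with [w'] eliminated
    by [dwE]. *)
Let E_hermitian a b :
  E a b.+1 + rho%:C%C * E a.+1 b.+1 = (E b a.+1 + rho%:C%C * E b.+1 a.+1)^*%C.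
Proof.
have h a' b' : ip (w^`() * ('X^(s.+1) * w ^+ a')) (w * ('X^(s.+1) * w ^+ b'))^`() =
  (m%:R / rho%:C%C) * (E a' b'.+1 + rho%:C%C * E a'.+1 b'.+1).
  have -> : w * ('X^(s.+1) * w ^+ b') = 'X^(s.+1) * w ^+ b'.+1 by rewrite (exprS w) mulrCA.
  rewrite dwE.
  have -> : 'X^s * (1 + rho%:C%C *: w) * w ^+ a' =
      'X^s * w ^+ a' + rho%:C%C *: ('X^s * w ^+ a'.+1).
    by move: lemniscate_coord => u; rewrite -!mul_polyC exprS; ring.
  by rewrite ipZl ipDl ipZl.
have := lemniscate_rotation_symmetry ('X^(s.+1) * w ^+ a) ('X^(s.+1) * w ^+ b).
rewrite -[RHS]ipJ !h conjcM.
have -> : (m%:R / rho%:C%C)^*%C = m%:R / rho%:C%C :> C.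
  by rewrite conjcM conjc_nat conjc_inv conjc_real.
by apply: mulfI; rewrite mulf_neq0 ?invr_eq0.
Qed.

(** By [E_shift], the first column [x] and the conjugated first row [y] determine all of [E]. *)
Let x n : C := E n 0.
Let y n : C := (E 0 n)^*%C.

Let x0_real : (x 0)^*%C = x 0.
Proof.
have := ipJ ('X^(s.+1) * w ^+ 0)^`() ('X^(s.+1) * w ^+ 0)^`().
rewrite {1 3}deriv_sector mul0r scale0r addr0 !ipZl -/(E 0 0) -/(x 0) addr0 !conjcM.
rewrite conjc_nat conjc_real => /(mulfI cm0); apply: mulfI.
by apply/eqP => /(congr1 (@complex.Re R)) /= /eqP; rewrite gt_eqF.
Qed.

Let y1_real : (y 1)^*%C = y 1.
Proof.
have := E_hermitian 0 0; rewrite !E_shift -/(x 0) conjcD conjcM conjc_real x0_real.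
by move=> /addIr; rewrite -/(y 1) {1}/y => e; rewrite /y conjcK.
Qed.

Let xy_rel n : y n.+2 + rho%:C%C * y n.+1 = x n + rho%:C%C * x n.+1.
Proof.
have := E_hermitian n.+1 0; rewrite !E_shift conjcD conjcM conjc_real.
by rewrite -/(x n) -/(x n.+1) -/(y n.+2) -/(y n.+1) => ->.
Qed.

Let y_step n : y n.+2 = x n + rho%:C%C * x n.+1 - rho%:C%C * y n.+1.
Proof.
by have := xy_rel n; move: (y n.+2) (y n.+1) (x n) (x n.+1) => a b u v <-; rewrite addrK.
Qed.

(** Hermitian symmetry of the area inner product for the derivatives of [z^(s+1)] and
    [z^(s+1) w^(n+1)], each expanded by [deriv_sector]. *)
Let x_rec n : (sigma%:C%C + n.+1%:R) * rho%:C%C * x n.+1 + n.+1%:R * x n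
  = sigma%:C%C * rho%:C%C * y n.+1.
Proof.
have := ipJ ('X^(s.+1) * w ^+ 0)^`() ('X^(s.+1) * w ^+ n.+1)^`().
rewrite {1}deriv_sector [in RHS]deriv_sector mul0r scale0r addr0 !ipZl ipDl !ipZl.
rewrite -!/(E _ _) -/(x n.+1) -/(x n) addr0 !conjcM -/(y n.+1) conjc_nat conjc_real.
move=> /(mulfI cm0); move: (x n) (x n.+1) (y n.+1) => a a' b e.
rewrite [RHS]mulrAC e [RHS]mulrDl [_ * a * _]mulrAC divfK//.
by rewrite [in RHS]mulrAC.
Qed.

Let x_bounded : exists B, forall n, cmod (x n) <= B.
Proof.
have [M1 hM1] := Cbounded_horner bG 'X^s.
have [M2 hM2] := Cbounded_horner bG ('X^(s.+1) * w ^+ 0)^`().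
pose area := fine (((@lebesgue_measure R) \x (@lebesgue_measure R))%E (planar G)).
exists (2 * (2 * (2 * (M1 * 1) * M2) * area)) => n.
apply: (Cbounded_Cintegral mG (planar_lty mG bG) (area_integrable mG bG _ _)).
apply: CboundedM (CboundedJ hM2) => xy Gxy.
have hw : Cbounded (planar G) 1 (fun xy => (w ^+ n).[Complex xy.1 xy.2]).
  move=> z /=; rewrite GE /G' /= => /ltW z1; rewrite horner_exp.
  have zn : cmod (w.[Complex z.1 z.2] ^+ n) <= 1 by rewrite cmodX exprn_ile1// cmod_ge0.
  by split; apply: le_trans zn; [exact: Re_le_cmod|exact: Im_le_cmod].
by have := CboundedM hM1 hw Gxy; rewrite -hornerM.
Qed.

Let cmod_rho z : cmod (rho%:C%C * z) = rho * cmod z.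
Proof. by rewrite cmodM (cmod_real (ltW rho0)). Qed.

Let y_bounded : exists B, forall n, cmod (y n) <= B.
Proof.
have [B hB] := x_bounded.
have B0 : 0 <= B := le_trans (cmod_ge0 _) (hB 0).
(* By [y_step], the sequence [y] contracts by [rho] up to terms of size [(1 + rho) B]; this [K]
   satisfies [(1 + rho) B + rho K <= K]. *)
pose K := cmod (y 1) + 2 * B / (1 - rho).
have q0 : 0 < 1 - rho by rewrite subr_gt0.
have K0 : 0 <= 2 * B / (1 - rho) by rewrite divr_ge0 ?mulr_ge0// ltW.
suff h n : cmod (y n.+1) <= K.
  exists (cmod (y 0) + K) => -[|n]; first by rewrite lerDl addr_ge0// cmod_ge0.
  by apply: (le_trans (h n)); rewrite lerDr cmod_ge0.
elim: n => [|n IH]; first by rewrite lerDl.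
have : cmod (y n.+2) <= B + rho * B + rho * K.
  rewrite y_step; apply: (le_trans (cmodB _ _)); apply: lerD.
    apply: (le_trans (cmodD _ _)); apply: lerD => //.
    by rewrite cmod_rho ler_pM2l.
  by rewrite cmod_rho ler_pM2l.
move=> /le_trans; apply.
have e : (1 - rho) * (2 * B / (1 - rho)) = 2 * B by rewrite mulrC divfK// gt_eqF.
have : rho * B <= B by rewrite ler_piMl// ltW.
have : 0 <= (1 - rho) * cmod (y 1) by rewrite mulr_ge0 ?cmod_ge0// ltW.
by rewrite /K; move: (2 * B / (1 - rho)) e K0 (cmod (y 1)) => t e K0 u; lra.
Qed.

(* The moments of the boundary functional: [x n = c n.+1 + rho c n] and
   [y n.+1 = c n + rho c n.+1]. *)
Let c n : C := (y n.+1 - rho%:C%C * x n) / (1 - rho%:C%C ^+ 2).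

Let q0 : 1 - rho%:C%C ^+ 2 != 0 :> C.
Proof.
have -> : 1 - rho%:C%C ^+ 2 = (1 - rho ^+ 2)%:C%C :> C by apply: complex_ext => /=; ring.
apply/eqP => /(congr1 (@complex.Re R)) /= /eqP; rewrite gt_eqF// subr_gt0.
by rewrite expr_lt1// ltW.
Qed.

Let cS n : c n.+1 = (x n - rho%:C%C * y n.+1) / (1 - rho%:C%C ^+ 2).
Proof.
by rewrite /c y_step; move: (x n) (x n.+1) (y n.+1) => a b d; congr (_ / _); ring.
Qed.

Let x_c n : x n = c n.+1 + rho%:C%C * c n.
Proof. by rewrite cS /c; field. Qed.

Let y_c n : y n.+1 = c n + rho%:C%C * c n.+1.
Proof. by rewrite cS /c; field. Qed.

(** Substituting [x_c] and [y_c] into [x_rec] gives exactly the recurrence of the circle moments. *)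
Let c_rec : satisfies_rec rho sigma c.
Proof.
move=> n; have := x_rec n; rewrite !x_c y_c.
move: (c n) (c n.+1) (c n.+2) => a b d /eqP; rewrite -subr_eq0 => /eqP e.
by rewrite -[RHS]e; ring.
Qed.

Let c_bounded : exists B, forall n, cmod (c n) <= B.
Proof.
have [B hB] := x_bounded; have [B' hB'] := y_bounded.
exists ((B' + rho * B) * cmod (1 - rho%:C%C ^+ 2)^-1) => n.
rewrite /c cmodM; apply: ler_wpM2r; first exact: cmod_ge0.
apply: (le_trans (cmodB _ _)); apply: lerD => //.
by rewrite cmod_rho ler_pM2l.
Qed.

Let c0_real : (c 0)^*%C = c 0.
Proof.
rewrite /c conjcM conjcB conjcM conjc_inv conjcB conjcX conjc1 conjc_real.
by rewrite x0_real y1_real.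
Qed.

Let h : C -> R := lemniscate_weight m r s.

Lemma lemniscate_weight_circle t : h (cis t) = (1 + rho ^+ 2 + 2 * rho * cos t) `^ (sigma - 1).
Proof.
set v := (1 + _ + _).
have v0 : 0 < v by exact: sqr_one_plus_rho_cis_gt0.
rewrite /h /lemniscate_weight -/rho.
have -> : cmod (rho%:C%C * cis t + 1) = v `^ 2^-1.
  rewrite powR12_sqrt ?ltW// /cmod normc_def /=; congr (Num.sqrt _).
  rewrite [LHS](_ : _ = rho ^+ 2 * (cos t ^+ 2 + sin t ^+ 2) + 2 * rho * cos t + 1).
    by rewrite cos2Dsin2 /v; ring.
  by ring.
(* The exponents agree because [1/m + s/m = sigma], and halving accounts for the square root of
   [v]. *)
rewrite -powRN -powRrM; congr (_ `^ _).
have mR : m%:R != 0 :> R by rewrite pnatr_eq0 -lt0n.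
by rewrite /sigma -natr1; field.
Qed.

Let hE := lemniscate_weight_circle.
Let mom := circle_moment h.

Let kappa : C := c 0 / mom 0.

Let mom0 : mom 0 != 0. Proof. exact: (circle_moment0_neq0 rho0 rho1 sigma1 hE). Qed.

Let kappa_real : kappa^*%C = kappa.
Proof.
rewrite /kappa conjcM c0_real conjc_inv; congr (_ / _).
by rewrite /mom /circle_moment (circle_ip_conj rho0 rho1 hE) expr0.
Qed.

(** The difference is a bounded solution of the recurrence, and the choice of [kappa] makes it
    vanish at 0. *)
Let c_mom n : c n = kappa * mom n.
Proof.
have [B hB] := c_bounded; have [B' hB'] := circle_moment_bounded rho0 rho1 sigma1 hE.
apply/eqP; rewrite -subr_eq0; apply/eqP.
apply: (@bounded_rec_eq0 _ rho sigma rho0 rho1 sigma0 sigma1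
  (fun n => c n - kappa * mom n) (B + cmod kappa * B')).
- move=> k; have h1 := c_rec k; have h2 := circle_moment_rec rho0 rho1 hE k.
  have := congr2 (fun a b => a - kappa * b) h1 h2; rewrite mulr0 subr0 /mom.
  move: kappa (c k) (c k.+1) (c k.+2) (circle_moment h k) (circle_moment h k.+1)
    (circle_moment h k.+2) => t a0 a1 a2 b0 b1 b2 h3.
  by rewrite -[RHS]h3; ring.
- by rewrite /kappa divfK ?subrr.
- move=> k; apply: (le_trans (cmodB _ _)); apply: lerD => //.
  by rewrite cmodM ler_wpM2l// cmod_ge0.
Qed.

Let cir_shift f q := circle_ip_shift hE f q.

(** Both sides are Toeplitz, so only the first column and row matter; there [x_c] and [y_c]
    reproduce the factor [w + rho]. In the row the moments appear conjugated, which is why [kappa]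
    must be real. *)
Let E_circle a b : E a b = kappa * circle_ip h (('X + (rho%:C%C)%:P) * 'X^a) 'X^b.
Proof.
move: kappa kappa_real c_mom => k kr cm.
elim: a b => [|a IH] [|b].
- rewrite -/(x 0) x_c !cm !expr0 mulr1 -[_%:P]mulr1 mul_polyC.
  rewrite (circle_ipDl rho0 rho1 hE) (circle_ipZl rho0 rho1 hE) /mom /circle_moment expr0 expr1.
  by ring.
- rewrite -[LHS]conjcK -/(y b.+1) y_c !cm expr0 mulr1 conjcD !conjcM kr conjc_real.
  rewrite (circle_ipDl rho0 rho1 hE) -[X in circle_ip h X _ + _]mulr1 {1}exprS cir_shift.
  rewrite -[_%:P]mulr1 mul_polyC (circle_ipZl rho0 rho1 hE).
  by rewrite /mom /circle_moment !(circle_ip_conj rho0 rho1 hE); ring.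
- rewrite -/(x a.+1) x_c !cm mulrDl -exprS mul_polyC.
  rewrite (circle_ipDl rho0 rho1 hE) (circle_ipZl rho0 rho1 hE) /mom /circle_moment expr0.
  by ring.
- by rewrite E_shift IH !exprS [_ * ('X * _)]mulrCA cir_shift.
Qed.

(** The map [sc] is the identity for the linear argument and conjugation for the other one. *)
Let poly_functional_ext (Phi Psi : {poly C} -> C) (sc : C -> C) :
  (forall f g, Phi (f + g) = Phi f + Phi g) -> (forall a f, Phi (a *: f) = sc a * Phi f) ->
  (forall f g, Psi (f + g) = Psi f + Psi g) -> (forall a f, Psi (a *: f) = sc a * Psi f) ->
  (forall i, Phi 'X^i = Psi 'X^i) -> Phi =1 Psi.
Proof.
move=> PhiD PhiZ PsiD PsiZ PhiPsi f.
have Phi0 : Phi 0 = 0 by apply: (addrI (Phi 0)); rewrite -PhiD !addr0.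
have Psi0 : Psi 0 = 0 by apply: (addrI (Psi 0)); rewrite -PsiD !addr0.
rewrite -[f]coefK poly_def.
elim/big_ind: _ => [|p q hp hq|i _]; first by rewrite Phi0 Psi0.
  by rewrite PhiD PsiD hp hq.
by rewrite PhiZ PsiZ PhiPsi.
Qed.

Lemma sector_form_circle : exists kappa : C, forall f g,
  sector_form f g = kappa * circle_ip h (('X + (rho%:C%C)%:P) * f) g.
Proof.
exists kappa => f g; move: kappa E_circle => k hk.
have cD := circle_ipDl rho0 rho1 hE; have cZ := circle_ipZl rho0 rho1 hE.
have cDr := circle_ipDr rho0 rho1 hE; have cZr := circle_ipZr rho0 rho1 hE.
apply: (@poly_functional_ext (sector_form ^~ g)
  (fun f => k * circle_ip h (('X + (rho%:C%C)%:P) * f) g) id) => [p q|a p|p q|a p|i].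
- by rewrite /sector_form rmorphD mulrDr ipDl.
- by rewrite /sector_form linearZ /= -scalerAr ipZl.
- by rewrite mulrDr cD mulrDr.
- by rewrite -scalerAr cZ mulrCA.
apply: (@poly_functional_ext (sector_form 'X^i)
  (fun g => k * circle_ip h (('X + (rho%:C%C)%:P) * 'X^i) g) (@conjc R)) => [p q|a p|p q|a p|j].
- by rewrite /sector_form rmorphD mulrDr derivD ipDr.
- by rewrite /sector_form linearZ /= -scalerAr derivZ ipZr.
- by rewrite cDr mulrDr.
- by rewrite cZr mulrCA.
by rewrite -hk /sector_form !comp_Xn_poly.
Qed.

End Sector.
End Lemniscate.

Lemma closed_prim_root_exists (F : closedFieldType) n : n%:R != 0 :> F ->
  exists z : F, n.-primitive_root z.
Proof.
move=> nF; have n0 : (0 < n)%N by case: n nF => //; rewrite eqxx.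
have [rs rsE] := closed_field_poly_normal ('X^n - 1 : {poly F}).
move: rsE; rewrite (monicP (monicXnsubC 1 n0)) scale1r => rsE.
suff /hasP[z _ hz] : has n.-primitive_root rs by exists z.
apply: has_prim_root => //.
- by apply/allP => z; rewrite -root_prod_XsubC -rsE /root !hornerE subr_eq0 unity_rootE.
- by rewrite -separable_prod_XsubC -rsE separable_Xn_sub_1.
- by rewrite -ltnS -(size_prod_XsubC rs id) -rsE size_XnsubC.
Qed.

(** * Identification of the Bergman polynomials of the lemniscate *)

Section BergmanPolynomials.
Context {R : realType}.
Local Notation C := R[i].
Variables (m : nat) (r : R).
Hypotheses (m2 : (2 <= m)%N) (r0 : 0 < r) (r1 : r < 1).
Local Notation G := (lemniscate m r).
Local Notation ip := (area_ip G).
Local Notation w := (lemniscate_coord m r).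
Local Notation rho := ((r ^+ m)%:C%C : C).

Let m0 : (0 < m)%N. Proof. exact: leq_trans m2. Qed.
Let mG := measurable_planar_lemniscate m r0.
Let bG := lemniscate_bounded m2 r0 r1.
Let crho0 : rho != 0.
Proof.
by apply/eqP => /(congr1 (@complex.Re R)) /= /eqP; rewrite gt_eqF// exprn_gt0.
Qed.

Let Xm : 'X^m = 1 + rho *: w.
Proof. by rewrite /lemniscate_coord scalerA mulfV// scale1r addrC subrK. Qed.

(** Rotation by a primitive [m]-th root of unity preserves [G] and scales the two polynomials by its
    distinct powers [a] and [j]. *)
Let rotation_orthogonal a j (p : {poly C}) : a != j %[mod m] ->
  ip ('X^a * (p \Po 'X^m)) 'X^j = 0.
Proof.
move=> aj; have mC : m%:R != 0 :> C by rewrite pnatr_eq0 -lt0n.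
have [z hz] := closed_prim_root_exists mC.
have zm := prim_expr_order hz.
apply: (@area_ip_rotation_orthogonal _ G 2 mG bG z a j).
- by apply/eqP; rewrite -(@pexpr_eq1 _ _ m)// -normrX zm normr1.
- by move=> t; rewrite /lemniscate /= exprMn zm mul1r.
- rewrite rmorphM /= comp_Xn_poly exprZn -scalerAl; congr (_ *: (_ * _)).
  by rewrite -comp_polyA comp_Xn_poly exprZn zm scale1r.
- by rewrite comp_Xn_poly exprZn.
- by rewrite (eq_prim_root_expr hz).
Qed.

Let w_comp : w = (rho^-1 *: ('X - 1)) \Po 'X^m.
Proof. by rewrite /lemniscate_coord linearZ /= rmorphB rmorph1 /= comp_polyX. Qed.

Let rotation_orthogonal_w a j (p : {poly C}) : a != j %[mod m] ->
  ip ('X^a * (p \Po w)) 'X^j = 0.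
Proof. by move=> aj; rewrite w_comp comp_polyA; exact: rotation_orthogonal. Qed.

Let size_w : size w = m.+1.
Proof. by rewrite /lemniscate_coord size_scale ?invr_eq0// size_XnsubC. Qed.

Let lead_w : lead_coef w = rho^-1.
Proof. by rewrite /lemniscate_coord lead_coefZ (monicP (monicXnsubC 1 m0)) mulr1. Qed.

Let one_plus l : 'X^(l * m) = (1 + rho *: 'X) ^+ l \Po w.
Proof.
by rewrite rmorphXn rmorphD rmorph1 /= linearZ /= comp_polyX -Xm -exprM mulnC.
Qed.

Let size_one_plus l : (size ((1 + rho *: 'X : {poly C}) ^+ l) <= l.+1)%N.
Proof.
apply: leq_trans (size_poly_exp_leq _ _) _.
have : (size (1 + rho *: 'X : {poly C})%R <= 2)%N.
  apply: leq_trans (size_polyD _ _) _; rewrite geq_max size_poly1 /=.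
  by apply: leq_trans (size_scale_leq _ _) _; rewrite size_polyX.
by case: (size _) => [|[|[|k]]]; rewrite //= ?mul1n ?mul0n.
Qed.

(** Only [j = l m + s] with [l < k] remains after rotation. Then [z^j] is a multiple of the
    derivative of [z^(s+1) (1 + rho w)^l], so the inner product is a multiple of [sector_form] at
    [g = (1 + rho w)^l], of degree at most [l]. *)
Lemma sector_orthogonal s (q : {poly C}) k : (s.+1 < m)%N ->
  (forall g : {poly C}, (size g <= k)%N ->
     circle_ip (lemniscate_weight m r s) (('X + rho%:P) * q) g = 0) ->
  forall j, (j < k * m + s)%N -> ip ('X^s * (q \Po w)) 'X^j = 0.
Proof.
move=> sm hq j jlt; have [sj|] := eqVneq (s %% m)%N (j %% m)%N; last exact: rotation_orthogonal_w.
have [kappa hk] := sector_form_circle m2 r0 r1 sm.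
rewrite (modn_small (ltnW sm)) in sj.
move: jlt; rewrite (divn_eq j m) -sj; set l := (j %/ m)%N => jlt.
have lk : (l < k)%N by move: jlt; rewrite ltn_add2r ltn_pmul2r.
have := hk q ((1 + rho *: 'X) ^+ l).
rewrite hq ?mulr0; last exact: leq_trans (size_one_plus l) lk.
rewrite /sector_form -one_plus -exprD addSn derivXn -scaler_nat (area_ipZr mG bG).
move=> /eqP; rewrite mulf_eq0 conjc_nat pnatr_eq0 /= addnC => /eqP; exact.
Qed.

Variable P : nat -> {poly C}.
Hypothesis hP : is_bergman_polys G P.

(** For exponents congruent to [m - 1], [z^j] is a multiple of the derivative of
    [z^((l+1) m) = (1 + rho w)^(l+1)], a polynomial in [w] alone, so Green's formula suffices
    without any circle weight. *)
Lemma bergman_last_sector k :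
  monic_of P (k * m + m - 1) = 'X^(m.-1) * ('X^m - 1) ^+ k.
Proof.
have sz1 : size ('X^m - 1 : {poly C}) = m.+1 by rewrite size_XnsubC.
have mon : ('X^m - 1 : {poly C}) \is monic by exact: monicXnsubC.
apply: (monic_of_unique mG bG hP).
- by rewrite (monicMr _ (monic_exp k mon)) monicXn.
- rewrite size_monicM ?monicXn ?monic_neq0 ?monic_exp// size_polyXn.
  have := size_exp ('X^m - 1 : {poly C}) k; rewrite sz1 /= => e.
  have : size (('X^m - 1 : {poly C}) ^+ k) = (m * k).+1.
    by rewrite -e prednK// size_poly_gt0 monic_neq0// monic_exp.
  by move=> ->; move: m0; rewrite mulnC; lia.
move=> j jlt.
have wE : 'X^m - 1 = rho *: w by rewrite Xm addrC addKr.
rewrite wE exprZn -scalerAr (area_ipZl mG bG).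
suff -> : ip ('X^(m.-1) * w ^+ k) 'X^j = 0 by rewrite mulr0.
have [sj|] := eqVneq (m.-1 %% m)%N (j %% m)%N; last first.
  by rewrite -(comp_Xn_poly w k); exact: rotation_orthogonal_w.
rewrite modn_small ?prednK// in sj.
move: jlt; rewrite (divn_eq j m) -sj; set l := (j %/ m)%N => jlt.
have lk : (l < k)%N.
  by move: jlt; rewrite -addnBA// subn1 ltn_add2r ltn_pmul2r.
have hb b : (b <= k)%N -> ip ('X^(m.-1) * w ^+ k) (w ^+ b)^`() = 0.
  case: b => [|b] bk; first by rewrite expr0 derivC (area_ip0r mG bG).
  (* Each use of Green's formula removes one [w] from both arguments, until the second is the
     derivative of a constant. *)
  have hgreen a : ip ('X^(m.-1) * w ^+ (a + b.+1)) (w ^+ b.+1)^`() = 0.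
    elim: b {bk} a => [|b IH] a.
      rewrite addn1 exprS mulrCA -[w ^+ 1]mulr1 expr1.
      by rewrite (lemniscate_green m2 r0 r1) derivC (area_ip0r mG bG).
    rewrite addnS exprS mulrCA [w ^+ b.+2]exprS (lemniscate_green m2 r0 r1).
    exact: IH.
  by rewrite -(subnK bk) hgreen.
have hg (g : {poly C}) : (size g <= k.+1)%N -> ip ('X^(m.-1) * w ^+ k) (g \Po w)^`() = 0.
  move=> gk; rewrite comp_polyE raddf_sum (area_ip_sumr mG bG) big1// => i _.
  by rewrite /= derivZ (area_ipZr mG bG) hb ?mulr0// -ltnS (leq_trans (ltn_ord i)).
have lk1 : (l.+2 <= k.+1)%N by rewrite ltnS.
have := hg ((1 + rho *: 'X) ^+ l.+1) (leq_trans (size_one_plus l.+1) lk1).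
rewrite -one_plus derivXn -scaler_nat (area_ipZr mG bG) => /eqP.
rewrite mulf_eq0 conjc_nat pnatr_eq0 muln_eq0 /= (gtn_eqF m0) /= => /eqP.
have -> // : (l * m + m.-1 = (l.+1 * m).-1)%N by move: m0; rewrite mulSn; lia.
Qed.

Lemma monic_orthogonal_neq0 s k (pik : {poly C}) : (s.+1 < m)%N ->
  is_monic_orthogonal (lemniscate_weight m r s) k pik -> pik.[- rho] != 0.
Proof.
move=> sm [mon sz orth]; apply/eqP => z0.
have /factor_theorem[q qE] : root pik (- rho) by apply/rootP.
have q0 : q != 0.
  by apply/eqP => q0; move: (monic_neq0 mon); rewrite qE q0 mul0r eqxx.
have szq : size q = k.
  by move: sz; rewrite qE size_Mmonic ?monicXsubC// size_XsubC addn2 /= => -[].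
have fo := @sector_orthogonal s q k sm.
have : 'X^s * (q \Po w) = 0.
  apply: (area_ip_definite mG bG hP).
  set f := 'X^s * _.
  (* Here [q] has degree [k - 1], so [f] has degree [(k - 1) m + s] and lies in the range covered by
     [sector_orthogonal]. *)
  have szf : (size f <= k * m + s)%N.
    rewrite /f; apply: leq_trans (size_polyMleq _ _) _; rewrite size_polyXn addSn /=.
    rewrite addnC leq_add2r.
    have := size_comp_poly q w; rewrite size_w szq /=.
    move: q0; rewrite -size_poly_gt0 szq; case: k {sz orth szq fo} => // k _ /= h.
    apply: leq_trans (leqSpred _) _; rewrite h mulSn -addn1 addnC leq_add2r.
    by [].
  rewrite -[X in ip _ X]coefK poly_def (area_ip_sumr mG bG) big1// => i _.
  rewrite (area_ipZr mG bG) fo ?mulr0//; last exact: leq_trans (ltn_ord i) szf.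
  by move=> g gk; rewrite -(orth g gk) qE polyCN opprK mulrC.
move/eqP; rewrite mulf_eq0 -size_poly_eq0 size_polyXn /= comp_poly_eq0 ?size_w//.
by rewrite (negbTE q0).
Qed.

Lemma bergman_sector s k (pk pk1 : {poly C}) (z : C) : (s.+1 < m)%N ->
  is_monic_orthogonal (lemniscate_weight m r s) k pk ->
  is_monic_orthogonal (lemniscate_weight m r s) k.+1 pk1 -> z ^+ s != 0 ->
  (monic_of P (k * m + s)).[z] * (z ^+ m - 1 + rho ^+ 2) / (z ^+ s * rho ^+ k.+1) =
  pk1.[(z ^+ m - 1) / rho] - pk1.[- rho] / pk.[- rho] * pk.[(z ^+ m - 1) / rho].
Proof.
move=> sm hk hk1 zs; have pk0 := monic_orthogonal_neq0 sm hk.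
have [mon sz orth] := hk; have [mon1 sz1 orth1] := hk1.
(* With this [c] the combination vanishes at [-rho] and is [(w + rho) q] with [q] monic of degree
   [k]. *)
set c := pk1.[- rho] / pk.[- rho].
have /factor_theorem[q qE] : root (pk1 - c *: pk) (- rho).
  by apply/rootP; rewrite !hornerE /c divfK// subrr.
have szlt : (size (- (c *: pk)) < size pk1)%N.
  by rewrite size_polyN sz1 ltnS -sz; exact: size_scale_leq.
have szN : size (pk1 - c *: pk) = k.+2 by rewrite size_polyDl.
have monN : (pk1 - c *: pk) \is monic by rewrite monicE lead_coefDl// -monicE.
have monq : q \is monic by move: monN; rewrite qE monicMr// monicXsubC.
have szq : size q = k.+1.
  by move: szN; rewrite qE size_Mmonic ?monicXsubC ?monic_neq0// size_XsubC addn2 /= => -[].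
have w1 : (1 < size w)%N by rewrite size_w.
(* The factor [rho^k] normalizes the leading coefficient, since [w] has leading coefficient
   [1 / rho]. *)
have pE : monic_of P (k * m + s) = rho ^+ k *: ('X^s * (q \Po w)).
  apply: (monic_of_unique mG bG hP).
  - rewrite monicE lead_coefZ lead_coefM lead_coefXn mul1r lead_coef_comp// lead_w.
    by rewrite (monicP monq) szq /= mul1r exprVn mulfV// expf_neq0.
  - rewrite size_scale ?expf_neq0// size_monicM ?monicXn ?comp_poly_eq0 ?monic_neq0// size_polyXn.
    have := size_comp_poly q w; rewrite size_w szq /= => h.
    have -> : size (q \Po w) = (k * m).+1.
      by rewrite -h prednK// size_poly_gt0 comp_poly_eq0 ?monic_neq0.
    by rewrite addnS addnC.
  move=> j jlt; rewrite (area_ipZl mG bG) (sector_orthogonal sm _ jlt) ?mulr0// => g gk.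
  have -> : ('X + rho%:P) * q = pk1 - c *: pk by rewrite qE polyCN opprK mulrC.
  have wE := lemniscate_weight_circle m2 r0 r1 s.
  have rm0 : 0 < r ^+ m by exact: exprn_gt0.
  have rm1 : r ^+ m < 1 by rewrite exprn_ilt1 ?ltW// -lt0n.
  rewrite -scaleNr (circle_ipDl rm0 rm1 wE) (circle_ipZl rm0 rm1 wE).
  by rewrite orth// orth1 ?mulr0 ?addr0// (leq_trans gk).
rewrite pE.
have wz : w.[z] = (z ^+ m - 1) / rho by rewrite /lemniscate_coord !hornerE mulrC.
rewrite hornerZ hornerM hornerXn horner_comp wz; set t := (z ^+ m - 1) / rho.
have -> : pk1.[t] - c * pk.[t] = q.[t] * (t + rho).
  have := congr1 (horner^~ t) qE; rewrite /= !hornerE => ->; by rewrite opprK.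
(* Consequently [z^m - 1 + rho^2 = rho (t + rho)], which uses up the remaining factor of
   [rho^(k+1)]. *)
have -> : z ^+ m - 1 = rho * t by rewrite /t mulrC divfK.
rewrite (exprS rho k); have := expf_neq0 k crho0; move: crho0 (rho ^+ k) zs.
move: t rho (z ^+ s) (q.[_]) => t p a qt.
by move=> p0 e a0 e0; field; rewrite p0 a0 e0.
Qed.

End BergmanPolynomials.

Local Close Scope classical_set_scope.

Theorem proposition7p2 (R : realType) (m : nat) (r : R)
    (P : nat -> {poly R[i]}) (ppi : nat -> nat -> {poly R[i]})
    (hm : (2 <= m)%N) (hr0 : 0 < r) (hr1 : r < 1)
    (hP : is_bergman_polys (lemniscate m r) P)
    (hppi : forall n s : nat, (s <= m - 2)%N ->
      is_monic_orthogonal (lemniscate_weight m r s) n (ppi n s)) :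
  let p := monic_of P in
  let rho : R[i] := (r%:C ^+ m)%C in
  (forall (k : nat) (z : R[i]),
     (p (k * m + m - 1)%N).[z] = z ^+ (m - 1) * (z ^+ m - 1) ^+ k) /\
  (forall s : nat, (s <= m - 2)%N ->
     exists K : nat, forall k : nat, (K <= k)%N ->
       (ppi k s).[- rho] != 0 /\
       forall z : R[i], z ^+ s != 0 ->
         let w := (z ^+ m - 1) / rho in
         (p (k * m + s)%N).[z] * (z ^+ m - 1 + r%:C%C ^+ (2 * m))
           / (z ^+ s * r%:C%C ^+ (m * (k + 1)))
         = (ppi (k + 1)%N s).[w]
           - (ppi (k + 1)%N s).[- rho] / (ppi k s).[- rho] * (ppi k s).[w]).
Proof.
move=> p rho; have rhoE : rho = (r ^+ m)%:C%C by rewrite rmorphXn.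
have m0 : (0 < m)%N by exact: leq_trans hm.
split=> [k z|s sm].
  rewrite /p (bergman_last_sector hm hr0 hr1 hP).
  by rewrite hornerM hornerXn horner_exp !hornerE subn1.
have sm' : (s.+1 < m)%N by lia.
(* The threshold can be 0 because [monic_orthogonal_neq0] excludes a zero at [-rho] for every
   [k]. *)
exists 0 => k _.
have hk := hppi k s sm; have hk1 := hppi (k + 1)%N s sm.
rewrite rhoE; split=> [|z zs w]; first exact: (monic_orthogonal_neq0 hm hr0 hr1 hP sm' hk).
rewrite addn1 in hk1 *.
rewrite -(bergman_sector hm hr0 hr1 hP sm' hk hk1 zs) /p.
by rewrite rmorphXn -!exprM [(2 * m)%N]mulnC.
Qed.
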